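(* Let $n\ge2$ and let $\mathscr A$ be an orientation of $A_{n-1}$. The intersection of $H$ with all $\mathscr A$-admissible half spaces is a polytope combinatorially equivalent to the $(n-1)$-dimensional associahedron, and its vertex set is exactly $\{M_{\mathscr A}(T):T\in\mathcal T_{n+2}\}$.
   Context: Let $[n]=\{1,\dots,n\}$. $A_{n-1}$ is the path with vertices $\tau_1,\dots,\tau_{n-1}$ and edges $\{\tau_i,\tau_{i+1}\}$; an orientation $\mathscr A$ directs each edge. $i\in\{2,\dots,n-1\}$ is up if $\{\tau_{i-1},\tau_i\}$ is directed from $\tau_i$ to $\tau_{i-1}$, down otherwise; $1,n$ are down; $\mathrm{Do}_{\mathscr A},\mathrm{Up}_{\mathscr A}$ are the sets of down/up elements, $\overline{\mathrm{Do}}_{\mathscr A}=\mathrm{Do}_{\mathscr A}\cup\{0,n+1\}$. Labelled polygon: in a convex $(n+2)$-gon $P$ label a vertex $0$, then counterclockwise the down elements increasingly, then $n+1$, then the up elements decreasingly. A triangulation $T$ is a set of $n-1$ non-crossing diagonals, viewed as a graph with the boundary edges of $P$; $\{a,b\}\in T$ means it is an edge; $\mathcal T_{n+2}$ is the set of triangulations. $\mu_i(j)$ ($i\in[n]$, $0\le j\le n+1$) counts edges of the boundary path from $i$ to $j$ using only labels $\le i$ if $j<i$, only labels $\ge i$ if $j\ge i$. $p^T_\ell(i)=\max\{\mu_i(a):0\le a<i,\{a,i\}\in T\}$, $p^T_r(i)=\max\{\mu_i(b):i<b\le n+1,\{i,b\}\in T\}$, $\omega_i=p^T_\ell(i)p^T_r(i)$,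 $x_i=\omega_i$ ($i$ down) or $n+1-\omega_i$ ($i$ up); $M_{\mathscr A}(T)=(x_1,\dots,x_n)$. For a diagonal $D=\{a,b\}$, $0\le a<b\le n+1$: $K_{\mathscr A}(D)=\{i\in\mathrm{Do}_{\mathscr A}:a<i<b\}$ if $a,b\in\overline{\mathrm{Do}}_{\mathscr A}$; $=\{i\in\mathrm{Do}_{\mathscr A}:a<i\}\cup\{i\in\mathrm{Up}_{\mathscr A}:b\le i\}$ if $a\in\overline{\mathrm{Do}}_{\mathscr A},b\in\mathrm{Up}_{\mathscr A}$; $=\mathrm{Do}_{\mathscr A}\cup\{i\in\mathrm{Up}_{\mathscr A}:i\le a\text{ or }b\le i\}$ if $a,b\in\mathrm{Up}_{\mathscr A}$; $=\{i\in\mathrm{Do}_{\mathscr A}:i<b\}\cup\{i\in\mathrm{Up}_{\mathscr A}:i\le a\}$ if $a\in\mathrm{Up}_{\mathscr A},b\in\overline{\mathrm{Do}}_{\mathscr A}$. $H=\{x\in\mathbb R^n:\sum_ix_i=n(n+1)/2\}$; for $\varnothing\ne K\subsetneq[n]$, $k=|K|$: $\mathscr H_K=\{x:(n-k)\sum_{i\in K}x_i-k\sum_{i\notin K}x_i+\tfrac{nk(n-k)}2\ge0\}$. $\mathscr H_K$ is $\mathscr A$-admissible if $K=K_{\mathscr A}(D)$ for some diagonal $D$ of $P$. The associahedron is the simple polytope whose face lattice is isomorphic to the poset of sets of non-crossing diagonals of an $(n+2)$-gon under reverse inclusion. *)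

(* Defs.v *)
From mathcomp Require Import all_boot all_order all_algebra.
From mathcomp Require Import boolp classical_sets functions cardinality reals.

Set Implicit Arguments.
Unset Strict Implicit.
Unset Printing Implicit Defensive.

Import Order.TTheory GRing.Theory Num.Theory.

Local Open Scope ring_scope.

(* A convex polygon enters only through [c], the duplicate-free list of all
   its vertices (all elements of [V]) in counterclockwise order; two chords of
   a convex polygon cross iff their endpoints strictly alternate in [c]. *)

Definition boundary_edge (V : finType) (c : seq V) (D : {set V}) : bool :=
  [exists a, D == [set a; next c a]%SET].

Definition is_diagonal (V : finType) (c : seq V) (D : {set V}) : bool :=
  (#|D| == 2)%N && ~~ boundary_edge c D.

Definition crossing (V : finType) (c : seq V) (D E : {set V}) : bool :=
  [exists a, exists b, exists x, exists y,
    [&& D == [set a; b]%SET, E == [set x; y]%SET &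
        (index a c < index x c < index b c)%N &&
        (index b c < index y c)%N
     || (index x c < index a c < index y c)%N &&
        (index y c < index b c)%N]].

Definition dissections (V : finType) (c : seq V) : {set {set {set V}}} :=
  [set S : {set {set V}} |
    [forall D in S, is_diagonal c D] &&
    [forall D in S, forall E in S, ~~ crossing c D E]]%SET.

Definition triangulations (V : finType) (c : seq V) : {set {set {set V}}} :=
  [set T in dissections c | #|T| == #|V| - 3]%SET%N.

Definition tri_edge (V : finType) (c : seq V) (T : {set {set V}})
    (a b : V) : bool :=
  ([set a; b]%SET \in T) || boundary_edge c [set a; b]%SET.

Local Open Scope classical_set_scope.

Definition convex_hull (R : realType) (m k : nat) (v : 'I_k -> 'rV[R]_m) :
    set 'rV[R]_m :=
  [set x | exists w : 'I_k -> R,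
    [/\ forall i, 0 <= w i, \sum_i w i = 1 & x = \sum_i w i *: v i]].

Definition polytope (R : realType) (m : nat) (P : set 'rV[R]_m) : Prop :=
  exists (k : nat) (v : 'I_k -> 'rV[R]_m), P = convex_hull v.

Definition affinely_independent (R : realType) (m k : nat)
    (v : 'I_k.+1 -> 'rV[R]_m) : bool :=
  row_free (\matrix_(i < k) (v (lift ord0 i) - v ord0)).

(* The affine hull of [P] has dimension [d]; never holds of the empty set. *)
Definition has_dim (R : realType) (m : nat) (P : set 'rV[R]_m) (d : nat) :
    Prop :=
  (exists v : 'I_d.+1 -> 'rV[R]_m,
     (forall i, P (v i)) /\ affinely_independent v) /\
  (forall (k : nat) (v : 'I_k.+1 -> 'rV[R]_m),
     (forall i, P (v i)) -> affinely_independent v -> (k <= d)%N).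

(* [set0] and [P] itself are faces, for c = 0 and b = 1, resp. b = 0. *)
Definition face (R : realType) (m : nat) (P F : set 'rV[R]_m) : Prop :=
  exists (c : 'rV[R]_m) (b : R),
    (forall x, P x -> \sum_i c 0 i * x 0 i <= b) /\
    F = [set x | P x /\ \sum_i c 0 i * x 0 i = b].

Definition vertex (R : realType) (m : nat) (P : set 'rV[R]_m)
    (x : 'rV[R]_m) : Prop := face P [set x].

Definition facet (R : realType) (m : nat) (P F : set 'rV[R]_m) : Prop :=
  face P F /\ exists e : nat, has_dim P e.+1 /\ has_dim F e.

Definition simple_polytope (R : realType) (m : nat) (P : set 'rV[R]_m) :
    Prop :=
  polytope P /\ exists2 d : nat, has_dim P d &
    forall x, vertex P x -> ([set F | facet P F /\ F x] #= `I_d)%card.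

(* [P] is a d-dimensional associahedron: a polytope in the combinatorial class
   of the (simple, d-dimensional) associahedron. The nonempty faces correspond
   to the dissections of a (d+3)-gon; the empty face is the bottom element to
   be added to the poset of dissections to make it a lattice. *)
Definition associahedron (R : realType) (m d : nat) (P : set 'rV[R]_m) :
    Prop :=
  [/\ simple_polytope P, has_dim P d &
      exists phi : {set {set 'I_d.+3}} -> set 'rV[R]_m,
        phi @` [set` dissections (enum 'I_d.+3)] =
          [set F | face P F /\ F !=set0] /\
        {in dissections (enum 'I_d.+3) &, forall S S',
          phi S `<=` phi S' <-> S' \subset S}].

(* The vertex tau_i of the path A_m is the ordinal i - 1 of 'I_m. *)
Definition path_edge (m : nat) (u v : 'I_m) : bool :=
  (u.+1 == v :> nat) || (v.+1 == u :> nat).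

(* [A u v] means that the edge {u, v} is directed from u to v. *)
Definition path_orientation (m : nat) (A : rel 'I_m) : Prop :=
  (forall u v, A u v -> path_edge u v) /\
  (forall u v, path_edge u v -> A u v (+) A v u).

(* There is an arc tau_i -> tau_(i-1); in particular 2 <= i <= n - 1. *)
Definition up (n : nat) (A : rel 'I_n.-1) (i : 'I_n.+2) : bool :=
  [exists u : 'I_n.-1, exists v : 'I_n.-1,
    [&& u.+1 == i :> nat, v.+2 == i :> nat & A u v]].

(* Neither 0 nor n + 1 is up, so this lists 0, the down elements increasingly,
   n + 1, the up elements decreasingly. *)
Definition polygon (n : nat) (A : rel 'I_n.-1) : seq 'I_n.+2 :=
  [seq i <- enum 'I_n.+2 | ~~ up A i] ++
  rev [seq i <- enum 'I_n.+2 | up A i].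

(* [arc c i j] lists the vertices met counterclockwise from i to j, without j,
   so its size is a number of edges. For i in [n] exactly one of the two
   boundary paths between i and j != i has only admitted labels. *)
Definition mu (n : nat) (A : rel 'I_n.-1) (i j : 'I_n.+2) : nat :=
  let c := polygon A in
  let admitted (k : 'I_n.+2) := if (j < i)%N then (k <= i)%N else (i <= k)%N in
  if all admitted (rcons (arc c i j) j) then size (arc c i j)
  else size (arc c j i).

Definition p_left (n : nat) (A : rel 'I_n.-1) (T : {set {set 'I_n.+2}})
    (i : 'I_n.+2) : nat :=
  (\max_(a : 'I_n.+2 | (a < i)%N && tri_edge (polygon A) T a i) mu A i a)%N.

Definition p_right (n : nat) (A : rel 'I_n.-1) (T : {set {set 'I_n.+2}})
    (i : 'I_n.+2) : nat :=
  (\max_(b : 'I_n.+2 | (i < b)%N && tri_edge (polygon A) T i b) mu A i b)%N.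

Definition weight (n : nat) (A : rel 'I_n.-1) (T : {set {set 'I_n.+2}})
    (i : 'I_n.+2) : nat :=
  (p_left A T i * p_right A T i)%N.

(* The ordinal i : 'I_n indexes the coordinate of label i + 1. *)
Definition label (n : nat) (i : 'I_n) : 'I_n.+2 :=
  lift ord0 (widen_ord (leqnSn n) i).

Definition M_of (R : realType) (n : nat) (A : rel 'I_n.-1)
    (T : {set {set 'I_n.+2}}) : 'rV[R]_n :=
  \row_(i < n)
    (if up A (label i) then n.+1%:R - (weight A T (label i))%:R
     else (weight A T (label i))%:R).

(* Meant for a < b. *)
Definition K_of (n : nat) (A : rel 'I_n.-1) (a b : 'I_n.+2) : {set 'I_n} :=
  [set i : 'I_n |
    let l := label i in
    match up A a, up A b with
    | false, false => ~~ up A l && (a < l < b)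
    | false, true => if up A l then b <= l else a < l
    | true, true => if up A l then (l <= a) || (b <= l) else true
    | true, false => if up A l then l <= a else l < b
    end]%SET%N.

Definition admissible (n : nat) (A : rel 'I_n.-1) (L : {set 'I_n}) : Prop :=
  exists a b : 'I_n.+2,
    [/\ (a < b)%N, is_diagonal (polygon A) [set a; b]%SET & L = K_of A a b].

Definition sum_hyperplane (R : realType) (n : nat) : set 'rV[R]_n :=
  [set x | \sum_i x 0 i = n%:R * n.+1%:R / 2].

Definition half_space (R : realType) (n : nat) (L : {set 'I_n}) :
    set 'rV[R]_n :=
  [set x | 0 <= (n%:R - #|L|%:R) * (\sum_(i in L) x 0 i)
                - #|L|%:R * (\sum_(i in ~: L) x 0 i)
                + n%:R * #|L|%:R * (n%:R - #|L|%:R) / 2].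

Definition admissible_intersection (R : realType) (n : nat)
    (A : rel 'I_n.-1) : set 'rV[R]_n :=
  [set x | sum_hyperplane x /\
           forall L : {set 'I_n}, admissible A L -> half_space L x].

Arguments admissible_intersection R [n] A.

(* Main.v *)
(* On the hyperplane H the half space of K reads x(K) >= z(|K|), where x(K) is
   the sum of the x_i over i in K and z(k) = k(k+1)/2. The set K(D) consists of
   the labels below the chord D, up endpoints included. If two chords cross,
   the union and the intersection of their sets are the sets of two opposite
   sides of the quadrilateral they span, and z is strictly supermodular; hence
   two crossing inequalities are never both tight.

   In a triangulation T every label i is the middle vertex of one triangle
   a < i < b, and the indicator vectors of its three sides together with the
   all-one vector span e_i. So the equations of T have at most one solution on
   H, and its coordinates are those of M(T). Each diagonal D of T borders two
   triangles, with middle labels i and j, and e_i - e_j is orthogonal to all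
   diagonals of T except D; so the equations are independent. The solution
   satisfies the remaining inequalities by induction on the number of diagonals
   of T crossed, using the quadrilateral inequality again. Since the recession
   cone is trivial, the polyhedron is a simple polytope with the required
   vertices and faces. *)
Require Import Defs.
From mathcomp Require Import all_boot all_order all_algebra.
From mathcomp Require Import boolp classical_sets functions cardinality reals.
From mathcomp Require Import lra ring zify.

Set Implicit Arguments.
Unset Strict Implicit.
Unset Printing Implicit Defensive.

Import Order.TTheory GRing.Theory Num.Theory.

(** * Chords in terms of labels *)

(** Incidence statements about a few labels depend only on their relative order and on which of them
    are up, so they are settled by splitting on every comparison that occurs and then on each value
    of [up]. *)
Ltac compare_nat p q :=
  case: (ltngtP p q) => ?; subst; rewrite ?ltnn ?leqnn ?eqxx //=;
  try (exfalso; lia).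

Ltac order_cases := repeat (match goal with
  | |- context [leq (S ?p) ?q] => compare_nat p q
  | |- context [leq ?p ?q] => compare_nat p q
  | |- context [@eq_op _ ?p ?q] =>
      match type of p with bool => fail 1 | _ => compare_nat p q end
  end).

Ltac bool_cases p := repeat match goal with
  | |- context [p ?k] => case: (p k) => //=
  end.

(** The order is a parameter because the pattern of [crossing] is used both for positions in the
    polygon and for labels ordered by [ccw]. *)
Definition alternate (T : Type) (lt : rel T) a b x y :=
  [&& lt a x, lt x b & lt b y] || [&& lt x a, lt a y & lt y b].

Definition xing_nat p q s t := [|| alternate ltn p q s t, alternate ltn q p s t,
  alternate ltn p q t s | alternate ltn q p t s].

Lemma xing_natE p q s t : xing_nat p q s t =
  [&& s != p, s != q, t != p, t != q &
      ((p < s < q) || (q < s < p)) != ((p < t < q) || (q < t < p))].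
Proof. by rewrite /xing_nat /alternate /=; order_cases. Qed.

(** Core of [triangle_inside]. A chord crossing [r q] but neither [p q] nor [p r] must end at [p]
    with its other end between [r] and [q], and the last two hypotheses forbid this. *)
Lemma inside_uncrossed p q r s t : p < r -> r < q ->
  ~~ xing_nat p q s t -> ~~ xing_nat p r s t ->
  (s == p) ==> ~~ (r < t < q) -> (t == p) ==> ~~ (r < s < q) ->
  ~~ xing_nat r q s t.
Proof. by move=> pr rq; rewrite !xing_natE; order_cases. Qed.

(** The same on the arc from [q] to [p] that wraps around: [before t] expresses that [r] is met no
    later than [t] on that arc. *)
Lemma outside_uncrossed p q r s t
    (before := fun t => (q < r) && ((t < p) || (r <= t)) || [&& r < p, t < p & r <= t]) :
  p < q -> (r < p) || (q < r) ->
  ~~ xing_nat p q s t -> ~~ xing_nat p r s t ->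
  (s == p) && ((t < p) || (q < t)) ==> before t ->
  (t == p) && ((s < p) || (q < s)) ==> before s ->
  ~~ xing_nat r q s t.
Proof. by rewrite /before => pq; rewrite !xing_natE; order_cases. Qed.

Section Labels.
Variable up : nat -> bool.
Implicit Types a b x y u v l : nat.

Ltac up_cases := bool_cases up.

(* For a < b and v distinct from a and b: the vertex v lies below the chord
   {a, b}, i.e. on the counterclockwise arc from a to b. *)
Definition below a b v :=
  if v < a then up a else if b < v then up b else ~~ up v.
(** Uniform form of the four cases of [K_of], as [mem_K_of] confirms. *)
Definition inK a b l := if (l == a) || (l == b) then up l else below a b l.
Definition crosses a b x y :=
  [&& x != a, x != b, y != a, y != b & below a b x != below a b y].

Lemma crossesC a b x y : crosses a b x y = crosses a b y x.
Proof.
by rewrite /crosses; move: (below a b x) (below a b y) => p q; lia.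
Qed.

Lemma crosses_sym a b x y : a < b -> x < y -> crosses a b x y = crosses x y a b.
Proof. by move=> ab xy; rewrite /crosses /below; order_cases; up_cases. Qed.

(** An uncrossed triangle lies on one side of the chord [x y]. The middle vertex [b] is counted on
    that side by [inK] even when it is an endpoint of the chord. *)
Lemma below_inK a b x y z v: x < y -> a < b -> b < z ->
  ~~ crosses x y a b -> ~~ crosses x y b z -> ~~ crosses x y a z ->
  v \in [:: a; b; z] -> v != x -> v != y -> inK x y b = below x y v.
Proof.
move=> xy ab bz + + + vs; rewrite /crosses /inK /below.
move: vs; rewrite !inE => /or3P[] /eqP->.
all: by order_cases; up_cases.
Qed.

(** With [a] the least label, [a y] and [x b] are opposite sides of the quadrilateral, already
    written in increasing order; the type of [x] decides which of them is the union. *)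
Lemma quad_inK a b x y l : a < x -> a < b -> x < y -> crosses a b x y ->
  inK a b l || inK x y l = (if up x then inK x b l else inK a y l) /\
  inK a b l && inK x y l = (if up x then inK a y l else inK x b l).
Proof.
move=> ax ab xy; rewrite /crosses /inK /below.
by order_cases; up_cases.
Qed.

Lemma crosses_lt a b x y : a < x -> a < b -> x < y -> crosses a b x y -> x < b.
Proof.
by move=> ax ab xy; rewrite /crosses /below; order_cases; up_cases.
Qed.

(** The labels [x] and [w] witness that neither set contains the other, which makes the supermodular
    inequality strict. *)
Lemma crosses_incomparable a b x y w : a < x -> a < b -> x < y ->
  crosses a b x y -> w = minn b y ->
  [/\ inK a b x = ~~ up x, inK x y x = up x,
      inK a b w = up x & inK x y w = ~~ up x].
Proof.
move=> ax ab xy + ->; rewrite /minn /crosses /inK /below.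
by order_cases; up_cases.
Qed.

(** A chord that enters the quadrilateral through a side has to cross one of its two diagonals. *)
Lemma quad_crosses a b x y u v : a < x -> a < b -> x < y -> u < v ->
  crosses a b x y -> crosses a y u v || crosses x b u v ->
  crosses a b u v || crosses x y u v.
Proof.
move=> ax ab xy uv; rewrite /crosses /below.
by order_cases; up_cases.
Qed.

(** For [i] down, the sets of the two short sides and the label [i] partition the set of the long
    side. For [i] up, the complements behave in this way. *)
Lemma triangle_inK a i b l : a < i -> i < b ->
  inK a i l + inK i b l + (if up i then 0 else l == i) =
  inK a b l + (if up i then (l == i).+1 else 0).
Proof.
move=> ai ib; rewrite /inK /below.
by order_cases; up_cases.
Qed.

(** A chord that enters the triangle through one side and crosses no other side leaves through the
    opposite vertex. *)
Lemma crosses_triangle a i b u v : a < i -> i < b -> u < v ->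
  crosses a b u v -> ~~ crosses a i u v -> ~~ crosses i b u v ->
  (u == i) || (v == i).
Proof.
move=> ai ib uv; rewrite /crosses /below.
by order_cases; up_cases.
Qed.

(** An edge from [i] across [a b] cuts off more of the boundary than the side of the triangle at [i]
    in the same direction. The inclusion is reversed for [i] up because [mu] then measures the
    complementary arc. *)
Lemma wider_left a i b w l : a < i -> i < b -> w < i -> crosses a b i w ->
  if up i then inK w i l ==> inK a i l else inK a i l ==> inK w i l.
Proof.
move=> ai ib wi; rewrite /crosses /inK /below.
by order_cases; up_cases.
Qed.

Lemma wider_left_strict a i b w : a < i -> i < b -> w < i -> crosses a b i w ->
  inK a i (maxn a w) = up i /\ inK w i (maxn a w) = ~~ up i.
Proof.
move=> ai ib wi; rewrite /maxn /crosses /inK /below.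
by order_cases; up_cases.
Qed.

Lemma wider_right a i b w l : a < i -> i < b -> i < w -> crosses a b i w ->
  if up i then inK i w l ==> inK i b l else inK i b l ==> inK i w l.
Proof.
move=> ai ib wi; rewrite /crosses /inK /below.
by order_cases; up_cases.
Qed.

Lemma wider_right_strict a i b w : a < i -> i < b -> i < w -> crosses a b i w ->
  inK i b (minn b w) = up i /\ inK i w (minn b w) = ~~ up i.
Proof.
move=> ai ib wi; rewrite /minn /crosses /inK /below.
by order_cases; up_cases.
Qed.

(* The order of the polygon: down labels increasingly, then up ones decreasingly. *)
Definition ccw u v := if up u then up v && (v < u) else up v || (u < v).

Lemma alternate_crosses a b x y : a < b ->
  [|| alternate ccw a b x y, alternate ccw b a x y,
      alternate ccw a b y x | alternate ccw b a y x] = crosses a b x y.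
Proof.
move=> ab; rewrite /alternate /ccw /crosses /below.
by order_cases; up_cases.
Qed.

Variable n : nat.

(** For [c = up i] this finds the neighbour of [i] on its own chain; for the other value, the left
    end of the boundary edge of the opposite chain that passes over [i]. The label 0 serves both
    chains. *)
Lemma gap_left c i : 0 < i -> exists2 a, a < i &
  ((a == 0) || (up a == c)) /\ forall k, (a < k < i) ==> (up k == ~~ c).
Proof.
elim: i => // i IHi _; case: (boolP ((i == 0) || (up i == c))) => Hi.
  by exists i => //; split=> // k; lia.
move: Hi; rewrite negb_or => /andP[i0 ui].
have [|a ai [ac ak]] := IHi; first by rewrite lt0n.
exists a; first exact: ltnW.
split=> // k; apply/implyP => /andP[k1 k2]; case: (eqVneq k i) => [->|ki]; last first.
  by apply: (implyP (ak k)); lia.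
by move: ui; case: (up i); case: (c).
Qed.

Lemma gap_right c i : i <= n -> exists2 b, i < b <= n.+1 &
  ((b == n.+1) || (up b == c)) /\ forall k, (i < k < b) ==> (up k == ~~ c).
Proof.
move: {2}(n - i) (erefl (n - i)) => m; elim: m i => [|m IHm] i im iN.
  exists n.+1; first by lia.
  by split=> [|k]; [rewrite eqxx | lia].
case: (boolP (up i.+1 == c)) => Hi.
  exists i.+1; first by lia.
  by split=> [|k]; [rewrite Hi orbT | lia].
have [||b ib [bc bk]] := IHm i.+1; [by lia|by lia|].
exists b; first by lia.
split=> // k; apply/implyP => k1; case: (eqVneq k i.+1) => [->|ki]; last first.
  by apply: (implyP (bk k)); lia.
by move: Hi; case: (up i.+1); case: (c).
Qed.

Hypotheses (up0 : up 0 = false) (upn : up n.+1 = false).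

(* Such a chord is a boundary edge; 0 and n + 1 count both as up and as down. *)
Definition gap (c : bool) a b := [/\ (a == 0) || (up a == c),
  (b == n.+1) || (up b == c) & forall k, (a < k < b) ==> (up k == ~~ c)].

Lemma gap_inK c a b l : a < b -> 0 < l <= n -> gap c a b -> inK a b l = c.
Proof.
case: c; move=> ab ln [+ + /(_ l)]; rewrite /inK /below; move: up0 upn.
all: by order_cases; up_cases.
Qed.

Lemma gap_uncrossed c a b u v : a < b -> u <= n.+1 -> v <= n.+1 -> gap c a b ->
  ~~ crosses a b u v.
Proof.
case: c => ab un vn [+ + H]; move: (H u) (H v); rewrite /crosses /below.
move: up0 upn.
all: by order_cases; up_cases.
Qed.

(* Replacing the endpoints of the chord by the labels 0 and n + 1, which lie on
   the side to which [inK] assigns them, turns membership into [below]. *)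
Lemma uncrossed_inK a b l l' : a < b -> b <= n.+1 -> 0 < l <= n -> 0 < l' <= n ->
  (forall u v, u <= n.+1 -> v <= n.+1 -> ~~ crosses a b u v) ->
  inK a b l = inK a b l'.
Proof.
move=> ab bn.
pose w l := if l == a then 0 else if l == b then n.+1 else l.
have wP k : 0 < k <= n -> [&& w k <= n.+1, w k != a, w k != b &
    inK a b k == below a b (w k)].
  move=> kn; rewrite /w /inK /below; move: up0 upn.
  by (case: (ltngtP k a) => [?|?|]; case: (ltngtP k b) => [?|?|] * /=; subst);
    order_cases; up_cases.
move=> /wP/and4P[w1 w2 w3 /eqP->] /wP/and4P[w4 w5 w6 /eqP->] /(_ (w l) (w l') w1 w4).
by rewrite /crosses w2 w3 w5 w6 /= negbK => /eqP.
Qed.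

End Labels.

(** * Dissections of a polygon *)

Lemma set2_eq (V : finType) (a b x y : V) : [set a; b] = [set x; y] ->
  (x = a /\ y = b) \/ (x = b /\ y = a).
Proof.
move=> E.
have /set2P ax : a \in [set x; y] by rewrite -E set21.
have /set2P bx : b \in [set x; y] by rewrite -E set22.
have /set2P xa : x \in [set a; b] by rewrite E set21.
have /set2P ya : y \in [set a; b] by rewrite E set22.
by case: ax bx xa ya => [?|?] [?|?] [?|?] [?|?]; subst; auto.
Qed.

Section Polygon.
Variables (V : finType) (c : seq V).
Hypotheses (uniq_c : uniq c) (mem_c : forall x, x \in c).
Implicit Types (a b u v x y : V) (T : {set {set V}}).

Local Notation pos x := (index x c).

Definition xing a b x y :=
  xing_nat (pos a) (pos b) (pos x) (pos y).

Lemma pos_inj : injective (fun x => pos x).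
Proof. by move=> x y; apply: index_inj. Qed.

Lemma pos_lt_size x : pos x < size c. Proof. by rewrite index_mem. Qed.

Lemma crossing_set a b x y : crossing c [set a; b] [set x; y] = xing a b x y.
Proof.
apply/existsP/idP => [[a' /existsP[b' /existsP[x' /existsP[y' H]]]]|].
  case/and3P: H => /eqP/set2_eq ab /eqP/set2_eq xy H.
  have {H} : alternate ltn (pos a') (pos b') (pos x') (pos y').
    by case/orP: H => /andP[/andP[h1 h2] h3]; rewrite /alternate /= h1 h2 h3 ?orbT.
  by rewrite /xing /xing_nat; case: ab => [[-> ->]|[-> ->]];
    case: xy => [[-> ->]|[-> ->]] ->;
    rewrite ?orbT.
have H a' b' x' y' : alternate ltn (pos a') (pos b') (pos x') (pos y') ->
    (pos a' < pos x' < pos b') && (pos b' < pos y')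
    || (pos x' < pos a' < pos y') && (pos y' < pos b').
  by case/orP => /and3P[/= -> -> ->]; rewrite ?orbT.
case/or4P => /H {}H.
- exists a; apply/existsP; exists b; apply/existsP; exists x; apply/existsP; exists y.
  by rewrite !eqxx H.
- exists b; apply/existsP; exists a; apply/existsP; exists x; apply/existsP; exists y.
  by rewrite finset.setUC !eqxx H.
- exists a; apply/existsP; exists b; apply/existsP; exists y; apply/existsP; exists x.
  by rewrite [[set x; y]]finset.setUC !eqxx H.
- exists b; apply/existsP; exists a; apply/existsP; exists y; apply/existsP; exists x.
  by rewrite [[set x; y]]finset.setUC [[set a; b]]finset.setUC !eqxx H.
Qed.

Lemma crossing_sym (D E : {set V}) : crossing c D E = crossing c E D.
Proof.
apply/idP/idP => /existsP[a /existsP[b /existsP[x /existsP[y /and3P[DE ED H]]]]];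
  apply/existsP; exists x; apply/existsP; exists y;
  apply/existsP; exists a; apply/existsP; exists b;
  by rewrite DE ED; case/orP: H => ->; rewrite ?orbT.
Qed.

Lemma xing_sym a b x y : xing a b x y = xing x y a b.
Proof. by rewrite -!crossing_set crossing_sym. Qed.

Lemma xingC a b x y : xing a b x y = xing b a x y.
Proof. by rewrite -!crossing_set finset.setUC. Qed.

Lemma pos_next x : pos (next c x) = if (pos x).+1 < size c then (pos x).+1 else 0.
Proof.
rewrite next_nth mem_c; case E: c (mem_c x) (pos_lt_size x) uniq_c => // [y s] _ _ u.
case: ifP => H; last by rewrite nth_default /= ?eqxx // leqNgt; exact: negbT.
by rewrite -[RHS](index_uniq y H u).
Qed.

Lemma xing_next a x y : ~~ xing a (next c a) x y.
Proof.
rewrite /xing xing_natE pos_next.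
have := pos_lt_size a; have := pos_lt_size x; have := pos_lt_size y.
move: (pos a) (pos x) (pos y) (size c) => p q r N; case: ifP; lia.
Qed.

Lemma boundary_uncrossed a b x y :
  boundary_edge c [set a; b] -> ~~ xing a b x y.
Proof.
case/existsP => a' /eqP/set2_eq [[<- <-]|[<- <-]]; last rewrite xingC;
exact: xing_next.
Qed.

Section Maximal.
Variable T : {set {set V}}.
Hypothesis T_dissection : T \in dissections c.
Hypothesis T_max : forall D, is_diagonal c D ->
  (forall E, E \in T -> ~~ crossing c D E) -> D \in T.

Lemma T_pair D : D \in T -> exists a b, a != b /\ D = [set a; b].
Proof.
move: T_dissection; rewrite inE => /andP[/forall_inP H _] /H.
case/andP => /cards2P[a [b [ab ->]]] _.
by exists a, b.
Qed.

Lemma tri_edgeC a b : tri_edge c T a b = tri_edge c T b a.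
Proof. by rewrite /tri_edge finset.setUC. Qed.

Lemma tri_edge_uncrossed a b x y : tri_edge c T a b -> tri_edge c T x y ->
  ~~ xing a b x y.
Proof.
case/orP => [abT|ab]; last by move=> _; exact: boundary_uncrossed.
case/orP => [xyT|xy]; last by rewrite xing_sym; exact: boundary_uncrossed.
move: T_dissection; rewrite inE => /andP[_ /forall_inP/(_ _ abT)/forall_inP/(_ _ xyT)].
by rewrite crossing_set.
Qed.

Lemma tri_edge_max a b : a != b ->
  (forall u v, u != v -> [set u; v] \in T -> ~~ xing a b u v) -> tri_edge c T a b.
Proof.
move=> ab H; rewrite /tri_edge orbC; case: (boolP (boundary_edge c _)) => //= B.
apply: T_max => [|E ET]; first by rewrite /is_diagonal cards2 ab.
have [u [v [uv Euv]]] := T_pair ET; rewrite Euv crossing_set.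
by apply: H => //; rewrite -Euv.
Qed.

Lemma tri_edge_next a : tri_edge c T a (next c a).
Proof. by apply/orP; right; apply/existsP; exists a. Qed.

(** Among the neighbours of [a] between [a] and [b], take the one nearest to [b]. An edge crossing
    [x b] would have to start at [a] and end nearer to [b]. *)
Lemma triangle_inside a b : [set a; b] \in T -> pos a < pos b ->
  exists x, [/\ pos a < pos x < pos b, tri_edge c T a x & tri_edge c T x b].
Proof.
move=> abT ab.
have abd : ~~ boundary_edge c [set a; b].
  by move: T_dissection; rewrite inE => /andP[/forall_inP/(_ _ abT)/andP[]].
have abE : tri_edge c T a b by rewrite /tri_edge abT.
pose Q x := (pos a < pos x < pos b) && tri_edge c T a x.
have Qn : Q (next c a).
  rewrite /Q tri_edge_next andbT.
  have : pos (next c a) != pos b.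
    apply/eqP => /pos_inj E; move/negP: abd; apply; rewrite -E.
    by apply/existsP; exists a.
  by rewrite pos_next; have := pos_lt_size b; case: ifP; lia.
case: (arg_maxnP (fun x => pos x) Qn) => x /andP[xab xE] xmax.
exists x; split=> //; apply: tri_edge_max => [|u v uv uvT].
  by apply/eqP => E; move: xab; rewrite E; lia.
have uvE : tri_edge c T u v by rewrite /tri_edge uvT.
have H1 := tri_edge_uncrossed abE uvE; have H2 := tri_edge_uncrossed xE uvE.
have far y : tri_edge c T a y -> ~~ (pos x < pos y < pos b).
  move=> yE; apply/negP => /andP[xy yb]; case/andP: xab => ax _.
  have /xmax : Q y by rewrite /Q yE yb (ltn_trans ax xy).
  by move=> /=; rewrite leqNgt xy.
case/andP: xab => ax xb.
apply: (inside_uncrossed ax xb H1 H2); apply/implyP => /eqP/pos_inj E; apply: far.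
  by rewrite -E.
by rewrite -E tri_edgeC.
Qed.

(** Again the neighbour of [a] nearest to [b], now on the arc running past the end of the list; the
    predecessor of [a] shows that there is a candidate. *)
Lemma triangle_outside a b : [set a; b] \in T -> pos a < pos b ->
  exists x, [/\ (pos x < pos a) || (pos b < pos x),
    tri_edge c T a x & tri_edge c T x b].
Proof.
move=> abT ab.
have abd : ~~ boundary_edge c [set a; b].
  by move: T_dissection; rewrite inE => /andP[/forall_inP/(_ _ abT)/andP[]].
have abE : tri_edge c T a b by rewrite /tri_edge abT.
(* [rank x] is the distance from [b] to [x] counterclockwise *)
pose rank x := if pos b < pos x then pos x - pos b else size c + pos x - pos b.
pose Q x := ((pos x < pos a) || (pos b < pos x)) && tri_edge c T a x.
have [x0 Q0] : exists x, Q x.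
  exists (prev c a); have na : next c (prev c a) = a by exact: next_prev.
  have nb : pos (prev c a) != pos b.
    apply/eqP => /pos_inj E; move/negP: abd; apply; rewrite -{1}na E finset.setUC.
    by apply/existsP; exists b.
  have -> : Q (prev c a) = (pos (prev c a) < pos a) || (pos b < pos (prev c a)).
    by rewrite /Q -[X in tri_edge c T X _]na tri_edgeC tri_edge_next andbT.
  have := pos_next (prev c a); rewrite na.
  have := pos_lt_size (prev c a); have := pos_lt_size b; case: ifP; lia.
case: (arg_minnP rank Q0) => x /andP[xab xE] xmin.
exists x; split=> //; apply: tri_edge_max => [|u v uv uvT].
  by apply/eqP => E; move: xab; rewrite E; lia.
have uvE : tri_edge c T u v by rewrite /tri_edge uvT.
have H1 := tri_edge_uncrossed abE uvE; have H2 := tri_edge_uncrossed xE uvE.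
pose before v := (pos b < pos x) && ((pos v < pos a) || (pos x <= pos v)) ||
  [&& pos x < pos a, pos v < pos a & pos x <= pos v].
have beforeP w : Q w -> before w.
  move=> Qw; have := xmin _ Qw; move: Qw => /andP[+ _]; move: xab.
  rewrite /before /rank; have := pos_lt_size x; have := pos_lt_size w.
  move: (pos_lt_size b) (pos x) (pos w) ab; move: (pos a) (pos b) (size c).
  clear=> p q N ? r s; case: ifP; case: ifP; lia.
apply: (outside_uncrossed ab xab H1 H2); apply/implyP => /andP[/eqP/pos_inj E w];
  apply: beforeP; rewrite /Q w -{1}E //.
by rewrite tri_edgeC.
Qed.

End Maximal.
End Polygon.

(** * Invariance of dissections under renaming the vertices *)

Section Relabelling.
Variables (V W : finType) (c : seq V) (c' : seq W) (f : V -> W) (f' : W -> V).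
Hypotheses (uniq_c : uniq c) (mem_c : forall x, x \in c).
Hypotheses (uniq_c' : uniq c') (mem_c' : forall x, x \in c').
Hypotheses (fK : cancel f f') (f'K : cancel f' f).
Hypothesis index_f : forall v, index (f v) c' = index v c.

Lemma relabel_size : size c = size c'.
Proof.
rewrite -(card_uniqP uniq_c) -(card_uniqP uniq_c').
rewrite (eq_card (B := predT)) => [|x]; last by rewrite mem_c.
rewrite [RHS](eq_card (B := predT)) => [|x]; last by rewrite mem_c'.
by apply: bij_eq_card; exists f'.
Qed.

Lemma relabel_next v : f (next c v) = next c' (f v).
Proof.
apply: (pos_inj mem_c'); rewrite /= index_f.
by rewrite (pos_next uniq_c mem_c) (pos_next uniq_c' mem_c') index_f relabel_size.
Qed.

Lemma relabel_boundary (D : {set V}) :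
  boundary_edge c D -> boundary_edge c' (f @: D).
Proof.
case/existsP => a /eqP ->; apply/existsP; exists (f a).
by rewrite imsetU1 imset_set1 relabel_next.
Qed.

Lemma relabel_crossing (D E : {set V}) :
  crossing c D E -> crossing c' (f @: D) (f @: E).
Proof.
case/existsP => a /existsP[b /existsP[x /existsP[y /and3P[/eqP-> /eqP-> H]]]].
apply/existsP; exists (f a); apply/existsP; exists (f b).
apply/existsP; exists (f x); apply/existsP; exists (f y).
by rewrite !imsetU1 !imset_set1 !eqxx !index_f.
Qed.

End Relabelling.

Definition relabel (V W : finType) (f : V -> W) (S : {set {set V}}) : {set {set W}} :=
  [set f @: (D : {set V}) | D in S].

Lemma imset_cancel (V W : finType) (f : V -> W) (f' : W -> V) :
  cancel f f' -> cancel (fun D : {set V} => f @: D) (fun D : {set W} => f' @: D).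
Proof. by move=> fK D; rewrite -imset_comp (eq_imset _ fK) imset_id. Qed.

Lemma relabelK (V W : finType) (f : V -> W) (f' : W -> V) :
  cancel f f' -> cancel (relabel f) (relabel f').
Proof. by move=> fK; apply: imset_cancel; exact: imset_cancel. Qed.

Lemma relabel_dissections (V W : finType) (c : seq V) (c' : seq W)
    (f : V -> W) (f' : W -> V) (S : {set {set V}}) :
  uniq c -> (forall x, x \in c) -> uniq c' -> (forall x, x \in c') ->
  cancel f f' -> cancel f' f -> (forall v, index (f v) c' = index v c) ->
  S \in dissections c -> relabel f S \in dissections c'.
Proof.
move=> uc mc uc' mc' fK f'K idx; rewrite !inE => /andP[/forall_inP H1 /forall_inP H2].
have idx' w : index (f' w) c = index w c' by rewrite -idx f'K.
have DK := imset_cancel fK.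
apply/andP; split.
  apply/forall_inP => _ /imsetP[D /H1 /andP[D2 Db] ->].
  rewrite /is_diagonal card_imset ?D2 /=; last exact: can_inj fK.
  by apply: contra Db => /(relabel_boundary uc' mc' uc mc f'K fK idx'); rewrite DK.
apply/forall_inP => _ /imsetP[D DS ->]; apply/forall_inP => _ /imsetP[E ES ->].
move/forall_inP: (H2 _ DS) => /(_ _ ES).
by apply: contra => /(relabel_crossing idx'); rewrite !DK.
Qed.

(** * The labelled polygon *)

Lemma pos_rot (V : eqType) (c : seq V) (a v : V) : uniq c -> a \in c -> v \in c ->
  index v (rot (index a c) c) =
  if index a c <= index v c then index v c - index a c
  else size c - index a c + index v c.
Proof.
move=> uc ac vc; set i := index a c.
have ic : i < size c by rewrite index_mem.
have := uc; rewrite -{1}(cat_take_drop i c) cat_uniq => /and3P[_ /hasPn dis _].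
have : index v c = index v (take i c ++ drop i c) by rewrite cat_take_drop.
rewrite index_cat /rot index_cat in_take // size_takel ?(ltnW ic) // size_drop.
have vtd : (v \in take i c) || (v \in drop i c) by rewrite -mem_cat cat_take_drop.
have := vtd; rewrite in_take //; case: ltnP => vi /= vd E.
  rewrite E; case: ifP => // /dis; rewrite in_take // vi.
  by move=> /negP.
by rewrite vd E addKn.
Qed.

Section PolygonLabels.
Variables (n : nat) (A : rel 'I_n.-1).
Local Notation c := (polygon A).
Local Notation pos x := (index x c).
Implicit Types a b i j u v x y : 'I_n.+2.

(** Transfers [up] to natural labels; [inord] sends labels out of range to 0, which is down. *)
Definition upl (k : nat) : bool := up A (inord k).

Lemma upE v : up A v = upl v. Proof. by rewrite /upl inord_val. Qed.

Lemma upl0 : upl 0 = false.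
Proof.
by apply/negbTE/existsPn => u; apply/existsPn => v; rewrite inordK //.
Qed.

Lemma upl_max : upl n.+1 = false.
Proof.
apply/negbTE/existsPn => u; apply/existsPn => v; rewrite inordK //.
by have := ltn_ord u; case: eqP => //=; lia.
Qed.

Lemma mem_polygon v : v \in c.
Proof.
rewrite mem_cat mem_rev; apply/orP.
by case: (boolP (up A v)) => uv; [right | left]; rewrite mem_filter uv mem_enum.
Qed.

Lemma uniq_polygon : uniq c.
Proof.
rewrite cat_uniq rev_uniq; apply/and3P; split; try exact/filter_uniq/enum_uniq.
by apply/hasPn => v; rewrite mem_rev /= !mem_filter => /andP[-> _].
Qed.

Lemma size_polygon : size c = n.+2.
Proof.
rewrite -(card_uniqP uniq_polygon) -[RHS]card_ord; apply: eq_card => v.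
by rewrite mem_polygon.
Qed.

(** Both halves of the polygon are sorted for [ccw], hence so is the whole list, and positions imply
    [ccw]. The converse follows since [ccw] is asymmetric. *)
Lemma pos_ccw u v : (pos u < pos v) = ccw upl u v.
Proof.
pose lt := [rel x y : 'I_n.+2 | ccw upl x y].
have lt_tr : transitive lt.
  move=> y x z; rewrite /lt /= /ccw.
  by case: (upl x) (upl y) (upl z) => [] [] [] //=; lia.
have srt : pairwise (fun x y : 'I_n.+2 => x < y) (enum 'I_n.+2).
  have -> : pairwise (fun x y : 'I_n.+2 => x < y) (enum 'I_n.+2) =
      pairwise ltn (map val (enum 'I_n.+2)) by rewrite pairwise_map.
  rewrite val_enum_ord -(sorted_pairwise ltn_trans).
  exact: iota_ltn_sorted.
have lt_sorted : sorted lt c.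
  rewrite sorted_pairwise // pairwise_cat; apply/and3P; split.
  - apply/allrelP => x y; rewrite mem_rev !mem_filter => /andP[ux _] /andP[uy _].
    by rewrite /= /ccw -!upE (negbTE ux) uy.
  - apply: (sub_in_pairwise (P := fun x => ~~ up A x)) (pairwise_filter _ srt).
      move=> x y; rewrite -[x \in _]/(~~ up A x) -[y \in _]/(~~ up A y) /=.
      by rewrite /ccw -!upE => /negbTE-> /negbTE->.
    exact: filter_all.
  rewrite -sorted_pairwise // rev_sorted sorted_pairwise; last first.
    by move=> y x z H1 H2; exact: lt_tr H2 H1.
  apply: (sub_in_pairwise (P := up A)) (pairwise_filter _ srt).
    move=> x y; rewrite -[x \in _]/(up A x) -[y \in _]/(up A y) /=.
    by rewrite /ccw -!upE => -> ->.
  exact: filter_all.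
have imp x y : pos x < pos y -> ccw upl x y.
  by apply: (sorted_ltn_index lt_tr lt_sorted); exact: mem_polygon.
apply/idP/idP; first exact: imp.
move=> uv; case: (ltngtP (pos u) (pos v)) => // [/imp|E].
  by move: uv; rewrite /ccw; case: (upl u) (upl v) => [] [] //=; lia.
have : u = v by apply: (pos_inj mem_polygon).
by move: uv => /[swap] ->; rewrite /ccw ltnn; case: (upl v).
Qed.

Lemma xing_crosses a b x y : a < b -> xing c a b x y = crosses upl a b x y.
Proof.
by move=> ab; rewrite -alternate_crosses // /xing /xing_nat /alternate /= !pos_ccw.
Qed.

Lemma label_val (l : 'I_n) : label l = l.+1 :> nat.
Proof. by rewrite /label /= /bump leq0n. Qed.

Lemma labelP v : 0 < v <= n -> exists l : 'I_n, label l = v.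
Proof.
move=> /andP[v0 vn]; have vn' : v.-1 < n by lia.
by exists (Ordinal vn'); apply: ord_inj; rewrite label_val /= prednK.
Qed.

Lemma mem_K_of a b (l : 'I_n) : a < b -> (l \in K_of A a b) = inK upl a b l.+1.
Proof.
move=> ab; rewrite inE; cbv zeta; rewrite -label_val !upE.
move: (nat_of_ord (label l)) => k.
rewrite /inK /below; move: (nat_of_ord a) (nat_of_ord b) ab => p q pq.
move: upl => U; case Ea: (U p); case Eb: (U q); case Ek: (U k);
  by move: Ea Eb Ek; order_cases; bool_cases U.
Qed.

Lemma mem_arc a b v : a < b ->
  (v \in arc c a b) = (v == a) || [&& v != a, v != b & below upl a b v].
Proof.
move=> ab; rewrite /arc in_take ?mem_rot ?mem_polygon //.
rewrite !pos_rot ?mem_polygon ?uniq_polygon //.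
(* The arc in terms of positions: either [v] follows [a] in the list, with [b] later or wrapped
   around, or [v] precedes [a] and the arc wraps around before reaching [v]. *)
transitivity (~~ (pos v < pos a) && ((pos b < pos a) || (pos v < pos b)) ||
    [&& pos v < pos a, pos b < pos a & pos v < pos b]).
  have := pos_lt_size mem_polygon a; have := pos_lt_size mem_polygon b.
  have := pos_lt_size mem_polygon v.
  by move: (pos a) (pos b) (pos v) (size c) => p q r N; case: ifP; case: ifP; lia.
rewrite !pos_ccw -!val_eqE /= /ccw /below.
move: (nat_of_ord a) (nat_of_ord b) (nat_of_ord v) ab => p q r pq.
by order_cases; bool_cases upl.
Qed.

Lemma uniq_arc a b : uniq (arc c a b).
Proof. by rewrite take_uniq // rot_uniq uniq_polygon. Qed.

Lemma arc_compl a b : a != b ->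
  size (arc c a b) + size (arc c b a) = n.+2 /\
  forall v, (v \in arc c b a) = (v \notin arc c a b).
Proof.
move=> ab; have [k p1 p2 <- <- E] :=
  rot_to_arc uniq_polygon (mem_polygon a) (mem_polygon b) ab.
split; first by rewrite -size_cat cat_cons -E size_rot size_polygon.
move=> v; have := mem_polygon v; rewrite -(mem_rot k) E -cat_cons mem_cat.
have := uniq_polygon; rewrite -(rot_uniq k) E -cat_cons cat_uniq => /and3P[_ /hasPn H _].
case: (boolP (v \in b :: p2)) => [/H/negbTE -> //|_]; by rewrite orbF => ->.
Qed.

(** Apart from [a], the arc consists of the vertices below the chord. Among these, 0 occurs exactly
    when [a] is up and [n + 1] exactly when [b] is up, which balances the up endpoints counted in
    [K_of]. *)
Lemma card_K_of a b : a < b -> #|K_of A a b|.+1 = size (arc c a b).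
Proof.
move=> ab; have bn := ltn_ord b.
pose F k := [&& k != a :> nat, k != b :> nat & below upl a b k].
have -> : size (arc c a b) = 1 + \sum_(v < n.+2) F v.
  rewrite -(card_uniqP (uniq_arc a b)) (cardD1 a) mem_arc // eqxx /=; congr (1 + _).
  rewrite -sum1_card big_mkcond /=; apply: eq_bigr => v _.
  rewrite inE /= mem_arc // /F -!val_eqE /=; by case: (val v == val a).
congr _.+1; rewrite -sum1_card big_mkcond /=.
rewrite (eq_bigr (fun l : 'I_n => F l.+1 + ((l.+1 == a) && upl a) +
    ((l.+1 == b) && upl b))); last first.
  move=> l _; rewrite mem_K_of // /F /inK; case: eqP => [->|_] /=.
    by rewrite (ltn_eqF ab) /= addn0; case: (upl a).
  by case: eqP => [->|_] /=; [case: (upl b) | case: below].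
have hit (d : nat) : d < n.+2 -> \sum_(l < n) ((l.+1 == d) && upl d : nat) = upl d.
  move=> dn; transitivity (\sum_(1 <= k < n.+1 | k == d) (upl k : nat)).
    rewrite big_add1 /= big_mkord [RHS]big_mkcond /=; apply: eq_bigr => l _.
    by case: eqP => [->|].
  rewrite big_nat1_eq; case: ifP => // /negbT; rewrite negb_and -leqNgt leqn0 -leqNgt.
  case/orP => [/eqP ->|nd]; first by rewrite upl0.
  have -> : d = n.+1 by lia.
  by rewrite upl_max.
rewrite !big_split /= !hit // big_ord_recl big_ord_recr /= /F /below.
have -> : bump 0 n = n.+1 by [].
move: upl0 upl_max; move: upl (nat_of_ord a) (nat_of_ord b) ab bn => U p q pq qn U0 Um.
have -> : [&& 0 != p, 0 != q &
    if 0 < p then U p else if q < 0 then U q else ~~ U 0] = U p.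
  by move: U0; order_cases; bool_cases U.
have -> : [&& n.+1 != p, n.+1 != q &
    if n.+1 < p then U p else if q < n.+1 then U q else ~~ U n.+1] = U q.
  by move: Um; order_cases; bool_cases U.
by rewrite [RHS]addnCA addnA.
Qed.

Lemma mu_left a i : a < i -> i <= n -> mu A i a =
  if upl i then n.+1 - #|K_of A a i| else #|K_of A a i|.+1.
Proof.
move=> ai iN; have nai : a != i by rewrite -val_eqE /= ltn_eqF.
have [sz ar] := arc_compl nai; rewrite card_K_of //.
rewrite /mu ai; case Eu: (upl i).
  rewrite ifT; first by move: sz; rewrite -(card_K_of ai); lia.
  apply/allP => v; rewrite mem_rcons inE => /orP[/eqP->|]; first exact: ltnW.
  rewrite ar mem_arc // leqNgt; apply: contra => iv.
  by rewrite -!val_eqE /= /below Eu iv ltnNge (ltnW (ltn_trans ai iv)) /=;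
    rewrite !gtn_eqF // (ltn_trans ai).
rewrite ifF //; apply/negbTE/allPn; exists ord_max; last by rewrite -ltnNge.
rewrite mem_rcons inE ar mem_arc // -!val_eqE /= /below Eu ltnNge.
have -> : a <= n.+1 by rewrite -ltnS.
by rewrite ltnS iN /= !andbF orbF gtn_eqF ?orbT // (leq_trans ai) // ltnW.
Qed.

Lemma mu_right i b : i < b -> 0 < i -> mu A i b =
  if upl i then n.+1 - #|K_of A i b| else #|K_of A i b|.+1.
Proof.
move=> ib i0; have nib : i != b by rewrite -val_eqE /= ltn_eqF.
have [sz ar] := arc_compl nib; rewrite card_K_of //.
rewrite /mu ltnNge (ltnW ib) /=; case Eu: (upl i).
  rewrite ifF.
    move: sz; rewrite -(card_K_of ib) => -[E].
    by rewrite -(addKn #|K_of A i b| (size _)) E.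
  apply/negbTE/allPn; exists ord0; last by rewrite -ltnNge.
  rewrite mem_rcons inE mem_arc // -!val_eqE /= /below Eu i0.
  by rewrite !ltn_eqF ?orbT // (ltn_trans i0).
rewrite ifT //; apply/allP => v.
rewrite mem_rcons inE => /orP[/eqP->|]; first exact: ltnW.
rewrite mem_arc // leqNgt; apply: contraL => vi.
by rewrite /below Eu vi -!val_eqE /= (ltn_eqF vi) (ltn_eqF (ltn_trans vi ib)).
Qed.

End PolygonLabels.

(** * Maximal dissections and the two triangles at a diagonal *)

Section Combinatorics.
Variables (n : nat) (A : rel 'I_n.-1).
Local Notation c := (polygon A).
Implicit Types a b i u v x y p q : 'I_n.+2.
Implicit Types S T : {set {set 'I_n.+2}}.

(** Triangulations are handled as inclusion-maximal dissections; that they are the ones with [n - 1]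
    diagonals is derived later by linear algebra, in [maximal_card] and [triangulationP]. *)
Definition maximal T := T \in dissections c /\
  forall D, is_diagonal c D -> (forall E, E \in T -> ~~ crossing c D E) -> D \in T.

Let uncrossed T (mT : maximal T) a b x y :=
  @tri_edge_uncrossed _ c (uniq_polygon A) (@mem_polygon n A) T mT.1 a b x y.
Let edge_max T (mT : maximal T) a b :=
  @tri_edge_max _ c T mT.1 mT.2 a b.

Lemma set2_lt (D : {set 'I_n.+2}) : #|D| == 2 ->
  exists a b, a < b /\ D = [set a; b]%SET.
Proof.
case/cards2P => a [b [ab ->]]; case: (ltngtP a b) => [lt|lt|/val_inj E].
- by exists a, b.
- by exists b, a; rewrite finset.setUC.
- by rewrite E eqxx in ab.
Qed.

Lemma dissection_lt S D : S \in dissections c -> D \in S ->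
  exists a b, a < b /\ D = [set a; b]%SET.
Proof.
rewrite inE => /andP[/forall_inP H _] /H /andP[/set2_lt].
by [].
Qed.

Lemma crossing_crosses a b x y : a < b ->
  crossing c [set a; b]%SET [set x; y]%SET = crosses (upl A) a b x y.
Proof. by move=> ab; rewrite crossing_set xing_crosses. Qed.

Lemma dissection_uncrossed S a b x y : S \in dissections c -> a < b ->
  [set a; b]%SET \in S -> [set x; y]%SET \in S -> ~~ crosses (upl A) a b x y.
Proof.
rewrite inE => /andP[_ /forall_inP H] ab abS xyS.
by rewrite -crossing_crosses //; move/forall_inP: (H _ abS); apply.
Qed.

Lemma tri_edge_crosses T a b x y : maximal T -> a < b -> tri_edge c T a b ->
  tri_edge c T x y -> ~~ crosses (upl A) a b x y.
Proof. by move=> mT ab e1 e2; rewrite -xing_crosses //; exact: (uncrossed mT e1 e2). Qed.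

Lemma tri_edge_uncrosses T a b : maximal T -> a < b ->
  (forall u v, u < v -> [set u; v]%SET \in T -> ~~ crosses (upl A) a b u v) ->
  tri_edge c T a b.
Proof.
move=> mT ab H; apply: (edge_max mT); first by rewrite -val_eqE /= ltn_eqF.
move=> u v uv uvT; rewrite xing_crosses //.
case: (ltngtP u v) => [lt|lt|/val_inj E]; first exact: H.
  by rewrite crossesC; apply: H; rewrite // finset.setUC.
by rewrite E eqxx in uv.
Qed.

Lemma dissections_sub S T : T \in dissections c -> S \subset T -> S \in dissections c.
Proof.
rewrite !inE => /andP[/forall_inP H1 /forall_inP H2] /fintype.subsetP ST.
apply/andP; split; first by apply/forall_inP => D /ST; exact: H1.
apply/forall_inP => D DS; apply/forall_inP => E ES.
by move/forall_inP: (H2 _ (ST _ DS)); apply; exact: ST.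
Qed.

Lemma crossing_irrefl (D : {set 'I_n.+2}) : #|D| == 2 -> ~~ crossing c D D.
Proof.
case/set2_lt => a [b [ab ->]]; rewrite crossing_crosses //.
by rewrite /crosses eqxx.
Qed.

Lemma dissection_extend S : S \in dissections c ->
  exists2 T, maximal T & S \subset T.
Proof.
move=> SD; pose Q T := (T \in dissections c) && (S \subset T).
have QS : Q S by rewrite /Q SD /=.
case: (arg_maxnP (fun T : {set {set 'I_n.+2}} => #|T|) QS) => T /andP[TD ST] Tmax.
exists T => //; split=> // D Dd Dx; apply/negPn/negP => DT.
have : Q (D |: T)%SET.
  rewrite /Q (fintype.subset_trans ST) ?subsetU1 // andbT inE.
  move: (TD); rewrite inE => /andP[/forall_inP H1 /forall_inP H2].
  apply/andP; split.
    by apply/forall_inP => E /setU1P[->|/H1].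
  apply/forall_inP => E /setU1P[->|ET]; apply/forall_inP => F /setU1P[->|FT].
  - by apply: crossing_irrefl; case/andP: Dd.
  - exact: Dx.
  - by rewrite crossing_sym; exact: Dx.
  - by move/forall_inP: (H2 _ ET); apply.
by move=> /Tmax; rewrite /= cardsU1 DT add1n ltnn.
Qed.

Lemma set2_sub_eq (D E : {set 'I_n.+2}) a b : #|E| == 2 -> D = [set a; b]%SET ->
  a \in E -> b \in E -> a != b -> D = E.
Proof.
move=> /eqP E2 -> aE bE ab; apply/eqP; rewrite eqEcard E2 cards2 ab leqnn andbT.
by rewrite finset.subUset !finset.sub1set aE bE.
Qed.

Lemma sorted_triangle_mid T a b x : maximal T -> a < b -> b < x ->
  tri_edge c T a b -> tri_edge c T b x -> tri_edge c T a x ->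
  exists l : 'I_n, forall p q v, p < q -> [set p; q]%SET \in T ->
    v \in [:: a; b; x] -> v != p -> v != q ->
    (l \in K_of A p q) = below (upl A) p q v.
Proof.
move=> mT ab bx eab ebx eax.
have [|l lb] := @labelP n b; first by have := ltn_ord x; lia.
exists l => p q v pq pqT vs vp vq; rewrite mem_K_of // -label_val lb.
have pqE : tri_edge c T p q by rewrite /tri_edge pqT.
apply: (@below_inK (upl A) a b p q x v) => //; try exact: (tri_edge_crosses mT).
Qed.

(** Reduction to [sorted_triangle_mid] by sorting the three vertices; the label obtained is that of
    the middle one. *)
Lemma triangle_mid T a b x : maximal T -> a != b -> b != x -> a != x ->
  tri_edge c T a b -> tri_edge c T b x -> tri_edge c T a x ->
  exists l : 'I_n, forall p q v, p < q -> [set p; q]%SET \in T ->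
    v \in [:: a; b; x] -> v != p -> v != q ->
    (l \in K_of A p q) = below (upl A) p q v.
Proof.
move=> mT nab nbx nax eab ebx eax.
have eba : tri_edge c T b a by rewrite tri_edgeC.
have exb : tri_edge c T x b by rewrite tri_edgeC.
have exa : tri_edge c T x a by rewrite tri_edgeC.
have [l1|l1|/val_inj E] := ltngtP a b; last by rewrite E eqxx in nab.
all: have [l2|l2|/val_inj E] := ltngtP b x; try by rewrite E eqxx in nbx.
all: have [l3|l3|/val_inj E] := ltngtP a x; try by rewrite E eqxx in nax.
all: try by exfalso; move: l1 l2 l3; clear; lia.
- exact: (sorted_triangle_mid mT l1 l2).
- have [l H] := sorted_triangle_mid mT l3 l2 eax exb eab; exists l => p q v pq pqT vs.
  by apply: H => //; move: vs; rewrite !inE; do 3!case: eqP.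
- have [l H] := sorted_triangle_mid mT l3 l1 exa eab exb; exists l => p q v pq pqT vs.
  by apply: H => //; move: vs; rewrite !inE; do 3!case: eqP.
- have [l H] := sorted_triangle_mid mT l1 l3 eba eax ebx; exists l => p q v pq pqT vs.
  by apply: H => //; move: vs; rewrite !inE; do 3!case: eqP.
- have [l H] := sorted_triangle_mid mT l2 l3 ebx exa eba; exists l => p q v pq pqT vs.
  by apply: H => //; move: vs; rewrite !inE; do 3!case: eqP.
- have [l H] := sorted_triangle_mid mT l2 l1 exb eba exa; exists l => p q v pq pqT vs.
  by apply: H => //; move: vs; rewrite !inE; do 3!case: eqP.
Qed.

(** [K_of] on unordered pairs, so that inequalities can be indexed by diagonals. *)
Definition chordK (D : {set 'I_n.+2}) : {set 'I_n} :=
  [set l | [exists a : 'I_n.+2, exists b : 'I_n.+2,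
    [&& a < b, D == [set a; b]%SET & l \in K_of A a b]]]%SET.

Lemma chordKE a b : a < b -> chordK [set a; b]%SET = K_of A a b.
Proof.
move=> ab; apply/setP => l; rewrite inE; apply/existsP/idP.
  move=> [a' /existsP[b' /and3P[ab' /eqP/set2_eq[[-> ->]|[E1 E2]] //]]].
  by move: ab'; rewrite E1 E2; lia.
by move=> lK; exists a; apply/existsP; exists b; rewrite ab eqxx lK.
Qed.

(* The middle labels of the two triangles bordering D: the chords other than D
   have both triangles on the same side. *)
Lemma separating_pair T D : maximal T -> D \in T -> exists i j : 'I_n,
  [/\ i \in chordK D, j \notin chordK D &
      forall E, E \in T -> E != D -> (i \in chordK E) = (j \in chordK E)].
Proof.
move=> mT DT; have [a [b [ab DE]]] :
    exists a b, index a c < index b c /\ D = [set a; b]%SET.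
  have [a [b [ab ->]]] := dissection_lt mT.1 DT.
  case: (ltngtP (index a c) (index b c)) => [lt|lt|E].
  - by exists a, b.
  - by exists b, a; rewrite finset.setUC.
  - by move: ab; rewrite (pos_inj (@mem_polygon n A) E); lia.
have abT : [set a; b]%SET \in T by rewrite -DE.
have eab : tri_edge c T a b by rewrite /tri_edge abT.
have [x [xab eax exb]] : exists x : 'I_n.+2, [/\ index a c < index x c < index b c,
    tri_edge c T a x & tri_edge c T x b] :=
  triangle_inside (uniq_polygon A) (@mem_polygon n A) mT.1 mT.2 abT ab.
have [y [yab eay eyb]] : exists y : 'I_n.+2,
    [/\ (index y c < index a c) || (index b c < index y c),
     tri_edge c T a y & tri_edge c T y b] :=
  triangle_outside (uniq_polygon A) (@mem_polygon n A) mT.1 mT.2 abT ab.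
have neq u v : index u c != index v c -> u != v by apply: contra => /eqP ->.
have nab : a != b by apply: neq; rewrite ltn_eqF.
have [nax nbx] : a != x /\ b != x.
  by split; apply: neq; move: ab xab; clear; lia.
have [nay nby] : a != y /\ b != y.
  by split; apply: neq; move: ab yab; clear; lia.
rewrite tri_edgeC in exb; rewrite tri_edgeC in eyb.
have [l lP] := triangle_mid mT nab nbx nax eab exb eax.
have [k kP] := triangle_mid mT nab nby nay eab eyb eay.
have same E : E \in T -> E != D -> (l \in chordK E) = (k \in chordK E).
  move=> ET ED; have [p [q [pq EE]]] := dissection_lt mT.1 ET.
  (* Since [E] differs from [D], it misses an endpoint of [D]. This vertex belongs to both
     triangles, so its side of [E] is the side of both middle labels. *)
  have [v vab vE] : exists2 v, v \in [:: a; b] & v \notin E.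
    have npq : p != q by rewrite -val_eqE /= ltn_eqF.
    have E2 : #|E| == 2 by rewrite EE cards2 npq.
    case: (boolP (a \in E)) => aE; last by exists a; rewrite ?inE ?eqxx.
    case: (boolP (b \in E)) => bE; last by exists b; rewrite ?inE ?eqxx ?orbT.
    by rewrite (set2_sub_eq E2 DE aE bE nab) eqxx in ED.
  have /andP[vp vq] : (v != p) && (v != q) by move: vE; rewrite EE !inE negb_or.
  rewrite EE chordKE //.
  rewrite EE in ET; have vs z : v \in [:: a; b; z].
    by move: vab; rewrite !inE => /orP[] ->; rewrite ?orbT.
  by rewrite (lP p q v) // (kP p q v).
(* The third vertices [x] and [y] lie on opposite sides of [D]. *)
have opp : (l \in chordK D) != (k \in chordK D).
  have [p [q [pq DE']]] := dissection_lt mT.1 DT.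
  have xy : crosses (upl A) p q x y.
    rewrite -crossing_crosses // -DE' DE crossing_set.
    suff : xing_nat (index a c) (index b c) (index x c) (index y c) by [].
    by rewrite xing_natE; move: ab xab yab; clear; lia.
  move: (xy) => /and5P[xp xq yp yq]; rewrite DE' chordKE //.
  rewrite (lP _ _ x) ?(kP _ _ y) ?inE ?eqxx ?orbT //.
  - by rewrite -DE'.
  - by rewrite -DE'.
case lD : (l \in chordK D) opp; case kD: (k \in chordK D) => // _.
  by exists l, k; rewrite lD kD.
by exists k, l; rewrite lD kD; split=> // E ET ED; rewrite same.
Qed.

End Combinatorics.

(** * The triangle of which a given label is the middle vertex *)

Section MiddleTriangle.
Variables (n : nat) (A : rel 'I_n.-1).
Local Notation c := (polygon A).
Implicit Types a b i u v w x y p q : 'I_n.+2.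
Implicit Types S T : {set {set 'I_n.+2}}.

Lemma proper_K_of a b x y k : a < b -> x < y -> 0 < k <= n ->
  (forall l, inK (upl A) a b l ==> inK (upl A) x y l) ->
  ~~ inK (upl A) a b k -> inK (upl A) x y k -> #|K_of A a b| < #|K_of A x y|.
Proof.
move=> ab xy kn sub k1 k2; apply/proper_card/properP; split.
  by apply/fintype.subsetP => l; rewrite !mem_K_of //; exact/implyP.
have [|l lk] := @labelP n (inord k); first by rewrite inordK //; lia.
have {}lk : l.+1 = k by rewrite -label_val lk inordK //; lia.
by exists l; rewrite mem_K_of // lk.
Qed.

Lemma mu_wider_left a i b w : a < i -> i < b -> i <= n -> w < i ->
  crosses (upl A) a b i w -> mu A i a < mu A i w.
Proof.
move=> ai ib iN wi H; rewrite !mu_left //.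
have [s1 s2] := wider_left_strict ai ib wi H.
have k0 : 0 < maxn a w <= n.
  by move: H => /and5P[_ _ + _ _]; move: ai wi iN; clear; lia.
have := fun l => wider_left l ai ib wi H; case Eu: (upl A i) s1 s2 => s1 s2 sub.
  have := proper_K_of wi ai k0 sub; rewrite s1 s2 => /(_ isT isT) lt.
  by apply: ltn_sub2l => //; rewrite ltnS -[n in (_ <= n)%N]card_ord max_card.
by rewrite ltnS; apply: (proper_K_of ai wi k0 sub); rewrite ?s1 ?s2.
Qed.

Lemma mu_wider_right a i b w : a < i -> i < b -> i <= n -> i < w ->
  crosses (upl A) a b i w -> mu A i b < mu A i w.
Proof.
move=> ai ib iN wi H; rewrite !mu_right //; try by move: ai; clear; lia.
have [s1 s2] := wider_right_strict ai ib wi H.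
have k0 : 0 < minn b w <= n.
  move: H => /and5P[_ _ _ + _]; have := ltn_ord b; have := ltn_ord w.
  by move: ib wi iN; clear; lia.
have := fun l => wider_right l ai ib wi H; case Eu: (upl A i) s1 s2 => s1 s2 sub.
  have := proper_K_of wi ib k0 sub; rewrite s1 s2 => /(_ isT isT) lt.
  by apply: ltn_sub2l => //; rewrite ltnS -[n in (_ <= n)%N]card_ord max_card.
by rewrite ltnS; apply: (proper_K_of ib wi k0 sub); rewrite ?s1 ?s2.
Qed.

Lemma gap_tri_edge T (d : bool) a b : maximal A T -> a < b -> gap (upl A) n d a b ->
  tri_edge c T a b.
Proof.
move=> mT ab G; apply: (tri_edge_uncrosses mT ab) => u v _ _.
by apply: (gap_uncrossed (upl0 A) (upl_max A) ab _ _ G); rewrite -ltnS.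
Qed.

Lemma gap_left_ord (d : bool) i : 0 < i -> exists2 a : 'I_n.+2, a < i &
  ((a == 0 :> nat) || (upl A a == d)) /\
  forall k, (a < k < i) ==> (upl A k == ~~ d).
Proof.
move=> i0; have [a ai H] := gap_left (upl A) d i0.
have an : a < n.+2 by apply: ltn_trans ai _.
by exists (Ordinal an).
Qed.

Lemma gap_right_ord (d : bool) i : i <= n -> exists2 b : 'I_n.+2, i < b &
  ((b == n.+1 :> nat) || (upl A b == d)) /\
  forall k, (i < k < b) ==> (upl A k == ~~ d).
Proof.
move=> iN; have [b /andP[ib bn] H] := gap_right (upl A) d iN.
have bn' : b < n.+2 by [].
by exists (Ordinal bn').
Qed.

(** Let [a] and [b] attain the two maxima. A diagonal of [T] across [a b] would end at [i], and its
    other end would have a larger [mu]; so [a b] is an edge by maximality of [T]. *)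
Lemma middle_triangle T i : maximal A T -> 0 < i <= n -> exists a b,
  a < i < b /\ [/\ tri_edge c T a i, tri_edge c T i b, tri_edge c T a b,
      p_left A T i = mu A i a & p_right A T i = mu A i b].
Proof.
move=> mT /andP[i0 iN].
(* The boundary neighbours of [i] show that neither maximum ranges over an empty set. *)
have [a0 ai0 [ga1 ga2]] := gap_left_ord (upl A i) i0.
have [b0 ib0 [gb1 gb2]] := gap_right_ord (upl A i) iN.
have Qa0 : (a0 < i) && tri_edge c T a0 i.
  rewrite ai0 (gap_tri_edge (d := upl A i)) //.
  by split=> //; rewrite eqxx orbT.
have Qb0 : (i < b0) && tri_edge c T i b0.
  rewrite ib0 (gap_tri_edge (d := upl A i)) //.
  by split=> //; rewrite eqxx orbT.
rewrite /p_left (bigop.bigmax_eq_arg a0) // /p_right (bigop.bigmax_eq_arg b0) //.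
case: arg_maxnP => //= a /andP[ai ea] amax.
case: arg_maxnP => //= b /andP[ib eb] bmax.
exists a, b; split; first by rewrite ai ib.
split=> //.
have ab := ltn_trans ai ib.
apply: (tri_edge_uncrosses mT ab) => u v uv uvT; apply/negP => H.
have euv : tri_edge c T u v by rewrite /tri_edge uvT.
have [w ew Hw] : exists2 w, tri_edge c T i w & crosses (upl A) a b i w.
  have := crosses_triangle ai ib uv H (tri_edge_crosses mT ai ea euv)
    (tri_edge_crosses mT ib eb euv).
  case/orP => /eqP/val_inj E; first by exists v; rewrite -E.
  by exists u; rewrite -E 1?tri_edgeC // crossesC.
case: (ltngtP w i) => [wi|wi|/val_inj E].
- have := amax w; rewrite wi tri_edgeC ew => /(_ isT).
  by rewrite leqNgt (mu_wider_left ai ib iN wi Hw).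
- have := bmax w; rewrite wi ew => /(_ isT).
  by rewrite leqNgt (mu_wider_right ai ib iN wi Hw).
- by move: Hw; rewrite E /crosses eqxx !andbF.
Qed.

End MiddleTriangle.



(** * Polyhedra with prescribed tight sets *)

Section Dot.
Local Open Scope ring_scope.
Variables (R : realType) (n : nat).
Implicit Types c x y : 'rV[R]_n.

Definition dot c x : R := \sum_i c 0 i * x 0 i.

Lemma dotC c x : dot c x = dot x c.
Proof. by apply: eq_bigr => i _; rewrite mulrC. Qed.

Lemma dotDr c x y : dot c (x + y) = dot c x + dot c y.
Proof. by rewrite -big_split; apply: eq_bigr => i _; rewrite mxE mulrDr. Qed.

Lemma dotZr c a x : dot c (a *: x) = a * dot c x.
Proof. by rewrite mulr_sumr; apply: eq_bigr => i _; rewrite mxE mulrCA. Qed.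

Lemma dotNr c x : dot c (- x) = - dot c x.
Proof. by rewrite -scaleN1r dotZr mulN1r. Qed.

Lemma dotBr c x y : dot c (x - y) = dot c x - dot c y.
Proof. by rewrite dotDr dotNr. Qed.

Lemma dot0r c : dot c 0 = 0.
Proof. by rewrite -(scale0r 0) dotZr mul0r. Qed.

Lemma dot_sumr c (I : Type) (r : seq I) (P : pred I) (F : I -> 'rV[R]_n) :
  dot c (\sum_(i <- r | P i) F i) = \sum_(i <- r | P i) dot c (F i).
Proof. by apply: (big_morph (dot c)); [exact: dotDr | exact: dot0r]. Qed.

Lemma dot_suml x (I : Type) (r : seq I) (P : pred I) (F : I -> 'rV[R]_n) :
  dot (\sum_(i <- r | P i) F i) x = \sum_(i <- r | P i) dot (F i) x.
Proof. by rewrite dotC dot_sumr; apply: eq_bigr => i _; rewrite dotC. Qed.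

Lemma dotE c x : (x *m c^T) 0 0 = dot c x.
Proof. by rewrite mxE; apply: eq_bigr => i _; rewrite mxE mulrC. Qed.

End Dot.

Lemma pos_lower_bound (R : realType) (I : finType) (F : I -> R) (A : {set I}) :
  (forall i, i \in A -> 0 < F i)%R ->
  exists2 e : R, (0 < e)%R & forall i, i \in A -> (e <= F i)%R.
Proof.
move=> F0; case: (set_0Vmem A) => [->|[i0 i0A]].
  by exists 1%R => // i; rewrite inE.
have [i iA imin] := arg_minP F i0A.
by exists (F i) => //; exact: F0.
Qed.

Lemma has_dim_unique (R : realType) (m : nat) (P : set 'rV[R]_m) (d e : nat) :
  has_dim P d -> has_dim P e -> d = e.
Proof.
move=> [[v [vP vi]] dmax] [[w [wP wi]] emax].
by apply/eqP; rewrite eqn_leq (emax _ _ vP vi) (dmax _ _ wP wi).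
Qed.

Section Polyhedron.
Local Open Scope classical_set_scope.
Local Open Scope ring_scope.
Variables (R : realType) (n m : nat) (I : finType).
Variables (Diag : {set I}) (g : I -> 'rV[R]_n) (z : I -> R).
Variables (u : 'rV[R]_n) (h : R).

Definition polyhedron : set 'rV[R]_n :=
  [set x | dot u x = h /\ forall D, D \in Diag -> z D <= dot (g D) x].

Local Notation P := polyhedron.

Definition tight (x : 'rV[R]_n) : {set I} :=
  [set D in Diag | dot (g D) x == z D]%SET.

Definition tight_face (S : {set I}) : set 'rV[R]_n :=
  [set x | P x /\ S \subset tight x].

Implicit Types (S T : {set I}) (x y d : 'rV[R]_n) (F : set 'rV[R]_n).

(** [DD] collects the possible tight sets and [MM] the maximal ones, [vtx T] having tight set [T].
    On the kernel of [u] the directions [delta T D] are dual to the normals of [T], and by [kerMM]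
    these normals determine a vector of that kernel. *)
Variables (DD MM : {set {set I}}) (vtx : {set I} -> 'rV[R]_n).
Variable delta : {set I} -> I -> 'rV[R]_n.

Hypothesis tightDD : forall x, P x -> tight x \in DD.
Hypothesis extMM : forall S, S \in DD -> exists2 T, T \in MM & S \subset T.
Hypothesis subDD : forall S T : {set I}, T \in DD -> S \subset T -> S \in DD.
Hypothesis MM_DD : forall T, T \in MM -> T \in DD.
Hypothesis cardMM : forall T, T \in MM -> #|T| = m.
Hypothesis vtxP : forall T, T \in MM -> P (vtx T).
Hypothesis tight_vtx : forall T, T \in MM -> tight (vtx T) = T.
Hypothesis u_delta : forall T D, T \in MM -> D \in T -> dot u (delta T D) = 0.
Hypothesis g_delta : forall T D E, T \in MM -> D \in T -> E \in T ->
  dot (g E) (delta T D) = (E == D)%:R.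
Hypothesis kerMM : forall T d, T \in MM -> dot u d = 0 ->
  (forall E, E \in T -> dot (g E) d = 0) -> d = 0.
Hypothesis recession : forall d, dot u d = 0 ->
  (forall D, D \in Diag -> 0 <= dot (g D) d) -> d = 0.
Hypothesis DD0 : finset.set0 \in DD.

Lemma tightP x D : D \in tight x -> dot (g D) x = z D.
Proof. by rewrite inE => /andP[_ /eqP]. Qed.

Lemma tight_Diag x D : D \in tight x -> D \in Diag.
Proof. by rewrite inE => /andP[]. Qed.

(** A short step keeps strict inequalities strict, and a tight one stays tight only if it is
    constant along [d]. *)
Lemma perturb x d : P x -> dot u d = 0 ->
  (forall D, D \in tight x -> 0 <= dot (g D) d) ->
  exists2 e : R, 0 < e & forall t, 0 < t <= e ->
    P (x + t *: d) /\
    tight (x + t *: d) = [set D in tight x | dot (g D) d == 0]%SET.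
Proof.
move=> [xh xz] du dt.
(* A safe step length for [D]; the summand 1 covers a vanishing derivative and keeps the inequality
   strict. *)
pose F D := (dot (g D) x - z D) / (1 + `|dot (g D) d|).
have [|e e0 eF] := @pos_lower_bound R I F ((Diag :\: tight x)%SET).
  move=> D; rewrite !inE => /andP[nt DD_]; apply: divr_gt0.
    by rewrite subr_gt0 lt_neqAle eq_sym xz // andbT; move: nt; rewrite DD_.
  by rewrite ltr_pwDl.
exists e => // t /andP[t0 te].
have slack D : D \in Diag -> D \notin tight x -> z D < dot (g D) (x + t *: d).
  move=> D1 D2; have := eF D; rewrite inE D1 D2 => /(_ isT); rewrite /F.
  have a0 : 0 <= `|dot (g D) d| by [].
  have ad : - `|dot (g D) d| <= dot (g D) d by rewrite lerNl ler_normr lexx orbT.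
  rewrite ler_pdivlMr ?ltr_pwDl // dotDr dotZr => H.
  have H2 : t * (1 + `|dot (g D) d|) <= e * (1 + `|dot (g D) d|).
    by rewrite ler_pM2r // ltr_pwDl.
  have H3 : t * - `|dot (g D) d| <= t * dot (g D) d by rewrite ler_pM2l.
  by nra.
split.
  split; first by rewrite dotDr dotZr du mulr0 addr0.
  move=> D D1; have [Dt|Dt] := boolP (D \in tight x); last exact/ltW/slack.
  by rewrite dotDr dotZr (tightP Dt) lerDl mulr_ge0 ?dt // ltW.
apply/setP => D; rewrite [in RHS]inE.
have [Dt|Dt] := boolP (D \in tight x).
  rewrite inE (tight_Diag Dt) /= dotDr dotZr (tightP Dt).
  by rewrite -subr_eq0 addrAC subrr add0r mulf_eq0 gt_eqF.
apply/negbTE; rewrite inE negb_and; case: (boolP (D \in Diag)) => //= D1.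
by rewrite gt_eqF // slack.
Qed.

Lemma polyhedron_mid x y : P x -> P y -> P (2^-1 *: (x + y)) /\
  tight (2^-1 *: (x + y)) = tight x :&: tight y.
Proof.
move=> [xh xz] [yh yz]; split.
  split; first by rewrite dotZr dotDr xh yh; lra.
  by move=> D D1; rewrite dotZr dotDr; have := xz _ D1; have := yz _ D1; lra.
apply/setP => D; rewrite !inE dotZr dotDr.
case: (boolP (D \in Diag)) => //= D1; have := xz _ D1; have := yz _ D1 => Hy Hx.
apply/eqP/andP => [E|[/eqP-> /eqP->]]; last by lra.
by split; apply/eqP; lra.
Qed.

(** Ratio test: some inequality decreases along [d] because the recession cone is trivial, and the
    first one to become tight determines the step. *)
Lemma exit_point x d : P x -> dot u d = 0 -> d != 0 ->
  (forall D, D \in tight x -> dot (g D) d = 0) ->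
  exists2 t : R, 0 < t &
    P (x + t *: d) /\ tight x \proper tight (x + t *: d).
Proof.
move=> Px du d0 dt; have [xh xz] := Px.
have [D0 D01 D0neg] : exists2 D, D \in Diag & dot (g D) d < 0.
  apply: contrapT => H; move/eqP: d0; apply; apply: recession => // D D1.
  by rewrite leNgt; apply/negP => H1; apply: H; exists D.
pose Q D := (D \in Diag) && (dot (g D) d < 0).
have QD0 : Q D0 by apply/andP.
pose F D := (dot (g D) x - z D) / - dot (g D) d.
have [D /andP[D1 Dneg] Dmin] := arg_minP F QD0.
have FE E : Q E -> F E * - dot (g E) d = dot (g E) x - z E.
  by case/andP=> _ En; rewrite /F mulfVK // oppr_eq0 lt_eqF.
have Dt : D \notin tight x.
  by apply/negP => /dt E; move: Dneg; rewrite E ltxx.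
have t0 : 0 < F D.
  apply: divr_gt0; last by rewrite oppr_gt0.
  rewrite subr_gt0 lt_neqAle eq_sym xz // andbT.
  by move: Dt; rewrite inE D1.
exists (F D) => //; split.
  split; first by rewrite dotDr dotZr du mulr0 addr0.
  move=> E E1; rewrite dotDr dotZr.
  case: (ltP (dot (g E) d) 0) => En.
    have QE : Q E by apply/andP.
    have := FE _ QE; have := Dmin _ QE => H1 H2.
    have H3 : F D * - dot (g E) d <= F E * - dot (g E) d.
      by rewrite ler_pM2r // oppr_gt0.
    by lra.
  have H1 : 0 <= F D * dot (g E) d by rewrite mulr_ge0 // ltW.
  by have := xz _ E1; lra.
apply/properP; split.
  apply/fintype.subsetP => E Et; rewrite inE (tight_Diag Et) /= dotDr dotZr.
  by rewrite (dt _ Et) mulr0 addr0 (tightP Et).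
exists D => //; rewrite inE D1 /= dotDr dotZr.
have := FE D; rewrite /Q D1 Dneg => /(_ isT); lra.
Qed.

Lemma vtx_unique x T : T \in MM -> P x -> T \subset tight x -> x = vtx T.
Proof.
move=> TM [xh xz] /fintype.subsetP Tx; apply/eqP; rewrite -subr_eq0; apply/eqP.
have [vh vz] := vtxP TM.
apply: (kerMM TM); first by rewrite dotBr xh vh subrr.
move=> E ET; rewrite dotBr (tightP (Tx _ ET)).
by move: (ET); rewrite -{1}(tight_vtx TM) => /tightP ->; rewrite subrr.
Qed.

Lemma delta_neq0 T D : T \in MM -> D \in T -> delta T D != 0.
Proof.
move=> TM DT; apply/eqP => E; have := g_delta TM DT DT.
by rewrite E dot0r eqxx => /eqP; rewrite eq_sym oner_eq0.
Qed.

Definition vtx_hull (x : 'rV[R]_n) := exists w : {set I} -> R,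
  [/\ forall T, 0 <= w T, \sum_(T in MM) w T = 1 &
      x = \sum_(T in MM) w T *: vtx T].

Lemma vtx_hull_segment x y t : 0 <= t <= 1 -> vtx_hull x -> vtx_hull y ->
  vtx_hull (t *: x + (1 - t) *: y).
Proof.
move=> /andP[t0 t1] [w [w0 w1 ->]] [v [v0 v1 ->]].
exists (fun T => t * w T + (1 - t) * v T); split.
- by move=> T; rewrite addr_ge0 // mulr_ge0 // subr_ge0.
- by rewrite big_split -!mulr_sumr /= w1 v1; lra.
- rewrite !scaler_sumr -big_split /=; apply: eq_bigr => T _.
  by rewrite !scalerA -scalerDl.
Qed.

Lemma vtx_hull_vtx T : T \in MM -> vtx_hull (vtx T).
Proof.
move=> TM; exists (fun T' => (T' == T)%:R); split=> [T'||].
- by rewrite ler0n.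
- by rewrite (bigD1 T) //= eqxx big1 ?addr0 // => T' /andP[_ /negbTE->].
- rewrite (bigD1 T) //= eqxx scale1r big1 ?addr0 // => T' /andP[_ /negbTE->].
  by rewrite scale0r.
Qed.

(** If [x] is not a vertex, some [D] in a maximal [T] containing the tight set is not tight at [x].
    The line through [x] along [delta T D] leaves the polyhedron on both sides at points with more
    tight inequalities, and [x] lies between them. *)
Lemma polyhedron_sub_hull x : P x -> vtx_hull x.
Proof.
move: {2}(#|I| - #|tight x|)%N (leqnn (#|I| - #|tight x|)%N) => k.
(* For [k = 0] all inequalities are tight at [x], so no such [D] exists. *)
elim: k x => [|k IHk] x kx Px;
  have [T TM xT] := extMM (tightDD Px);
  (case: (boolP (T \subset tight x)) => [Tx|/subsetPn[D DT Dx]];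
     first by rewrite (vtx_unique TM Px Tx); exact: vtx_hull_vtx);
  have := max_card (mem (tight x :|: [set D]%SET)); rewrite finset.setUC cardsU1 Dx.
  by lia.
move=> cardx; have D0 := delta_neq0 TM DT.
have uD := u_delta TM DT.
have gD E : E \in tight x -> dot (g E) (delta T D) = 0.
  move=> Ex; rewrite (g_delta TM DT (fintype.subsetP xT _ Ex)).
  by case: eqP Ex => // ->; rewrite (negbTE Dx).
have [s s0 [Ps /proper_card xs]] := exit_point Px uD D0 gD.
have [||E Ex|t t0 [Pt /proper_card xt]] := @exit_point x (- delta T D) Px.
- by rewrite dotNr uD oppr0.
- by rewrite oppr_eq0.
- by rewrite dotNr gD ?oppr0.
have hs := IHk _ _ Ps; have ht := IHk _ _ Pt.
have st : 0 < s + t by rewrite addr_gt0.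
have -> : x = (t / (s + t)) *: (x + s *: delta T D) +
              (1 - t / (s + t)) *: (x + t *: - delta T D).
  have -> : 1 - t / (s + t) = s / (s + t) by field; rewrite gt_eqF.
  apply/rowP => i; rewrite !mxE; field; rewrite gt_eqF //.
apply: vtx_hull_segment.
- by rewrite ler_pdivrMr // ler_pdivlMr //; lra.
- by apply: hs; move: kx cardx xs; clear; lia.
- by apply: ht; move: kx cardx xt; clear; lia.
Qed.

Lemma polyhedron_polytope : polytope P.
Proof.
exists #|MM|, (fun i => vtx (enum_val i)); apply/seteqP; split=> x.
  move=> /polyhedron_sub_hull[w [w0 w1 ->]].
  exists (fun i => w (enum_val i)); split=> //.
  - by rewrite -[RHS]w1 [in RHS]big_enum_val.
  - by rewrite [in LHS]big_enum_val.
move=> [w [w0 w1 ->]].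
have vP (i : 'I_#|MM|) : P (vtx (enum_val i)) by apply: vtxP; exact: enum_valP.
split.
  rewrite dot_sumr (eq_bigr (fun i => w i * h)).
    by rewrite -mulr_suml w1 mul1r.
  by move=> i _; rewrite dotZr; have [-> _] := vP i.
move=> D D1; rewrite dot_sumr -[z D]mul1r -w1 mulr_suml.
apply: ler_sum => i _; rewrite dotZr ler_wpM2l //.
by have [_ ->] := vP i.
Qed.

(** Starting from [vtx T] with [S] inside [T], a short step along the sum of the dual directions of
    [T :\: S] loosens exactly these inequalities. *)
Lemma tight_surj S : S \in DD -> exists2 x, P x & tight x = S.
Proof.
move=> SD; have [T TM ST] := extMM SD.
pose d := \sum_(D in T :\: S) delta T D.
have dE E : E \in T -> dot (g E) d = (E \notin S)%:R.
  move=> ET; rewrite dot_sumr; case: (boolP (E \in S)) => ES /=.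
    apply: big1 => D; rewrite inE => /andP[DS DT].
    by rewrite (g_delta TM DT ET); case: eqP DS ES => // -> /negP.
  rewrite (bigD1 E) ?inE ?ES //= (g_delta TM) // eqxx big1 ?addr0 // => D.
  by rewrite inE => /andP[/andP[_ DT] /negbTE nD]; rewrite (g_delta TM) // eq_sym nD.
have [|D|e e0 He] := @perturb (vtx T) d (vtxP TM).
- by rewrite dot_sumr big1 // => D; rewrite inE => /andP[_ DT]; rewrite (u_delta TM).
- by rewrite (tight_vtx TM) => DT; rewrite dE.
have [|Pe te] := He e; first by rewrite e0 lexx.
exists (vtx T + e *: d) => //; rewrite te; apply/setP => D.
rewrite inE (tight_vtx TM).
case: (boolP (D \in T)) => /= DT; last first.
  by apply/esym/negbTE; apply: contra DT; exact: (fintype.subsetP ST).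
by rewrite dE //; case: (D \in S) => /=; rewrite ?eqxx ?oner_eq0.
Qed.

Lemma tight_face_sub S S' : S \in DD ->
  tight_face S `<=` tight_face S' <-> S' \subset S.
Proof.
move=> /tight_surj[x Px tx]; split=> [/(_ x)|S'S y [Py Sy]].
  by case=> [|_]; [split; rewrite // tx | rewrite tx].
by split=> //; exact: fintype.subset_trans Sy.
Qed.

(** The supporting functional is minus the sum of the normals of [S]; it attains its bound exactly
    where all slacks vanish. *)
Lemma tight_face_face S : S \subset Diag -> face P (tight_face S).
Proof.
move=> /fintype.subsetP SDiag.
have slack x : P x -> forall D, D \in S -> 0 <= dot (g D) x - z D.
  by move=> [_ xz] D DS; rewrite subr_ge0 xz ?SDiag.
have E x : \sum_i (- \sum_(D in S) g D) 0 i * x 0 i =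
    - (\sum_(D in S) z D) - \sum_(D in S) (dot (g D) x - z D).
  by rewrite -/(dot _ _) dotC dotNr dotC dot_suml big_split /= sumrN; lra.
exists (- \sum_(D in S) g D), (- \sum_(D in S) z D); split=> [x Px|].
  by rewrite E gerBl sumr_ge0 // => D; exact: slack.
apply/seteqP; split=> x [Px Sx]; split=> //.
  rewrite E [X in _ - X]big1 ?subr0 // => D DS.
  by rewrite (tightP (fintype.subsetP Sx _ DS)) subrr.
apply/fintype.subsetP => D DS; rewrite inE SDiag //= -subr_eq0.
have : \sum_(D in S) (dot (g D) x - z D) == 0.
  by move: Sx; rewrite E; lra.
rewrite psumr_eq0; last exact: slack.
by move=> /allP/(_ D); rewrite mem_index_enum DS; exact.
Qed.

Lemma DD_Diag S : S \in DD -> S \subset Diag.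
Proof.
move=> /tight_surj[x _ <-]; apply/fintype.subsetP => D; exact: tight_Diag.
Qed.

(* A point of [F] with as few tight inequalities as possible lies in the
   relative interior of [F]; a segment of [P] through it stays in [F]. *)
Lemma face_tight F : face P F -> F !=set0 ->
  exists2 S, S \in DD & F = tight_face S.
Proof.
move=> [c [b [cb FE]]] F0.
pose Q k := `[< exists2 x, F x & #|tight x| = k >].
have exQ : exists k, Q k.
  by case: F0 => x Fx; exists #|tight x|; apply/asboolP; exists x.
case: (ex_minnP exQ) => k /asboolP[x Fx xk] kmin.
have Px : P x by move: Fx; rewrite FE => -[].
have cx : dot c x = b by move: Fx; rewrite FE => -[].
exists (tight x); first exact: tightDD.
apply/seteqP; split=> y.
  move=> Fy; have Py : P y by move: Fy; rewrite FE => -[].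
  have cy : dot c y = b by move: Fy; rewrite FE => -[].
  split=> //; have [Pm tm] := polyhedron_mid Px Py.
  have Fm : F (2^-1 *: (x + y)).
    by rewrite FE; split=> //; rewrite -/(dot _ _) dotZr dotDr cx cy; lra.
  have : (k <= #|tight x :&: tight y|)%N.
    by apply: kmin; apply/asboolP; exists (2^-1 *: (x + y)); rewrite ?tm.
  rewrite -xk => H; apply/finset.setIidPl/eqP.
  by rewrite eqEcard finset.subsetIl.
move=> [Py /fintype.subsetP xy]; rewrite FE; split=> //.
have [||e e0 He] := @perturb x (x - y) Px.
- by rewrite dotBr Px.1 Py.1 subrr.
- by move=> D Dx; rewrite dotBr (tightP Dx) (tightP (xy _ Dx)) subrr.
have [|Pe _] := He e; first by rewrite e0 lexx.
have := cb _ Pe; rewrite -!/(dot _ _) dotDr dotZr dotBr cx => H.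
have := cb _ Py; rewrite -!/(dot _ _) => H2.
by apply/eqP; rewrite eq_le H2 /=; nra.
Qed.

Lemma tight_face_nonempty S : S \in DD -> tight_face S !=set0.
Proof. by move=> /tight_surj[x Px xS]; exists x; split; rewrite ?xS. Qed.

Lemma vertex_tight x : vertex P x <-> P x /\ tight x \in MM.
Proof.
split=> [vx|[Px xM]].
  have [|S SD xS] := face_tight vx; first by exists x.
  have [T TM ST] := extMM SD.
  have : tight_face S (vtx T) by split; [exact: vtxP | rewrite tight_vtx].
  by rewrite -xS => /= <-; split; [exact: vtxP | rewrite tight_vtx].
rewrite /vertex; suff -> : [set x] = tight_face (tight x).
  exact/tight_face_face/DD_Diag/tightDD.
apply/seteqP; split=> [y ->|y [Py xy]]; first by split.
by rewrite /= (vtx_unique xM Py xy) -(vtx_unique xM Px).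
Qed.

(** By [kerMM], pairing with the normals in [T :\: S] is injective on the row space of [V]. This
    bounds the dimension of a face and later also the size of [T] from below. *)
Lemma orthogonal_family_card k (V : 'M[R]_(k, n)) T S : T \in MM ->
  row_free V -> (forall i, dot u (row i V) = 0) ->
  (forall i D, D \in S -> dot (g D) (row i V) = 0) ->
  (k <= #|T :\: S|%SET)%N.
Proof.
move=> TM Vfree Vu VS.
pose B := \matrix_(i < n, j < #|T :\: S|) g (enum_val j) 0 i.
have lin (r : 'rV[R]_k) c : dot c (r *m V) = \sum_i r 0 i * dot c (row i V).
  rewrite mulmx_sum_row dot_sumr; apply: eq_bigr => i _; exact: dotZr.
suff : row_free (V *m B) by move=> /eqP <-; exact: rank_leq_col.
rewrite -kermx_eq0; apply/eqP/row_matrixP => i; rewrite row0.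
set r := row i _; have rVB : r *m V *m B = 0.
  by rewrite -mulmxA /r -row_mul mulmx_ker row0.
suff rV : r *m V = 0 by apply: (row_free_inj Vfree); rewrite rV mul0mx.
apply: (kerMM TM) => [|E ET].
  by rewrite lin big1 // => j _; rewrite Vu mulr0.
have [ES|ES] := boolP (E \in S).
  by rewrite lin big1 // => j _; rewrite VS ?mulr0.
have ETS : E \in T :\: S by rewrite inE ES ET.
have := congr1 (fun M : 'rV_#|T :\: S| => M 0 (enum_rank_in ETS E)) rVB.
rewrite !mxE => <-; apply: eq_bigr => j _.
by rewrite !mxE enum_rankK_in // mulrC.
Qed.

(** From a point with tight set [S], a short step along each dual direction of [T :\: S] stays in
    the face. This gives enough affinely independent points. *)
Lemma tight_face_dim S : S \in DD -> has_dim (tight_face S) (m - #|S|).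
Proof.
move=> SD; have [T TM ST] := extMM SD; have [x Px xS] := tight_surj SD.
have cTS : #|T :\: S| = (m - #|S|)%N.
  by rewrite cardsD (finset.setIidPr ST) (cardMM TM).
split; last first.
  move=> k v vS vfree; rewrite -cTS; apply: (orthogonal_family_card TM vfree).
    by move=> i; rewrite rowK dotBr !(proj1 (proj1 (vS _))) subrr.
  move=> i D DS; rewrite rowK dotBr.
  by rewrite !(tightP (fintype.subsetP (proj2 (vS _)) _ DS)) subrr.
rewrite -cTS.
have dP (j : 'I_#|T :\: S|) : exists2 e : R, 0 < e &
    tight_face S (x + e *: delta T (enum_val j)).
  have := enum_valP j; rewrite inE => /andP[jS jT].
  have d0 D : D \in tight x -> dot (g D) (delta T (enum_val j)) = 0.
    rewrite xS => DS; rewrite (g_delta TM jT (fintype.subsetP ST _ DS)).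
    by case: eqP DS => // ->; rewrite (negbTE jS).
  have [||e e0 He] := @perturb x (delta T (enum_val j)) Px.
  - exact: u_delta.
  - by move=> D /d0 ->.
  have [|Pe te] := He e; first by rewrite e0 lexx.
  exists e => //; split=> //; rewrite te; apply/fintype.subsetP => D.
  by rewrite -{1}xS => Dx; rewrite inE Dx d0 /=.
have /cid[e eP] : exists e : 'I_#|T :\: S| -> R, forall j, 0 < e j /\
    tight_face S (x + e j *: delta T (enum_val j)).
  exists (fun j => projT1 (cid2 (dP j))) => j.
  by case: cid2.
exists (fun i => if unlift ord0 i is Some j
                 then x + e j *: delta T (enum_val j) else x); split.
  move=> i; case: unliftP => [j _|_]; first by have [] := eP j.
  by split=> //; rewrite xS.
(* The normals, rescaled by the step lengths, form a right inverse of the matrix of differences. *)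
apply/row_freeP; exists (\matrix_(i, j) ((e j)^-1 * g (enum_val j) 0 i)).
apply/matrixP => i j; rewrite !mxE.
have iT : enum_val i \in T by have := enum_valP i; rewrite inE => /andP[].
have jT : enum_val j \in T by have := enum_valP j; rewrite inE => /andP[].
transitivity ((e j)^-1 * (e i * dot (g (enum_val j)) (delta T (enum_val i)))).
  rewrite !mulr_sumr; apply: eq_bigr => l _; rewrite !mxE liftK unlift_none.
  by rewrite !mxE; ring.
rewrite (g_delta TM) // (inj_eq enum_val_inj) eq_sym.
by case: eqP => [->|_]; rewrite ?mulr1 ?mulr0 // mulVf // gt_eqF //; have [] := eP j.
Qed.

Lemma polyhedron_tight0 : P = tight_face finset.set0.
Proof.
by apply/seteqP; split=> [x Px|x []] //; split=> //; exact: finset.sub0set.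
Qed.

Lemma polyhedron_dim : has_dim P m.
Proof.
rewrite polyhedron_tight0 -[X in has_dim _ X]subn0 -(@cards0 I).
exact: tight_face_dim.
Qed.

Lemma polyhedron_faces :
  tight_face @` [set` DD] = [set F | face P F /\ F !=set0].
Proof.
apply/seteqP; split=> [_ [S SD <-]|F [fF F0]].
  by split; [exact/tight_face_face/DD_Diag | exact: tight_face_nonempty].
by have [S SD ->] := face_tight fF F0; exists S.
Qed.

(** By the dimension formula, the facets through [x] correspond to the single inequalities tight at
    [x]. *)
Lemma vertex_facets x : vertex P x ->
  ([set F | facet P F /\ F x] #= `I_m)%card.
Proof.
move=> /vertex_tight[Px xM].
have D1 D : D \in tight x -> [set D]%SET \in DD.
  by move=> Dx; apply: subDD (MM_DD xM) _; rewrite finset.sub1set.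
have -> : [set F | facet P F /\ F x] =
    (fun D => tight_face [set D]%SET) @` [set` tight x].
  apply/seteqP; split=> [F [[fF [e [Pe Fe]]] Fx]|_ [D Dx <-]].
    have [|S SD FS] := face_tight fF; first by exists x.
    have eS : e = (m - #|S|)%N.
      by apply: (has_dim_unique Fe); rewrite FS; exact: tight_face_dim.
    have em : e.+1 = m by exact: (has_dim_unique Pe polyhedron_dim).
    have : S \subset tight x by move: Fx; rewrite FS => -[].
    (* As [S] has at most [m] elements, the truncated subtraction in [eS] is exact. *)
    move=> Sx; have /cards1P[D DS] : #|S| == 1%N.
      by have := subset_leq_card Sx; rewrite (cardMM xM); lia.
    exists D; last by rewrite FS DS.
    by move: Sx; rewrite DS finset.sub1set.
  split; last by split=> //; rewrite finset.sub1set.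
  split; first by apply: tight_face_face; apply: DD_Diag; exact: D1.
  have m0 : (0 < m)%N by rewrite -(cardMM xM); apply/card_gt0P; exists D.
  exists m.-1; rewrite prednK //; split; first exact: polyhedron_dim.
  by rewrite -subn1 -(cards1 D); apply: tight_face_dim; exact: D1.
rewrite -(cardMM xM).
apply: (@card_eq_trans _ _ _ _ [set` tight x]).
  apply: inj_card_eq => D E; rewrite !inE => Dx Ex DE.
  have : [set D]%SET \subset [set E]%SET.
    by apply/tight_face_sub; [exact: D1 | rewrite DE].
  by rewrite finset.sub1set inE => /eqP.
have -> : `I_#|tight x| = (fun D => index D (enum (tight x))) @` [set` tight x].
  apply/seteqP; split=> [k kx|_ [D Dx <-]] /=; last first.
    by rewrite cardE index_mem mem_enum.
  exists (enum_val (Ordinal kx)); first exact: enum_valP.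
  by rewrite index_uniq ?enum_uniq // -cardE.
apply/card_esym/inj_card_eq => D E; rewrite !inE => Dx Ex.
by apply: index_inj => //; rewrite mem_enum.
Qed.

Lemma polyhedron_simple : simple_polytope P.
Proof.
split; first exact: polyhedron_polytope.
exists m; [exact: polyhedron_dim | exact: vertex_facets].
Qed.

Lemma polyhedron_structure :
  [/\ simple_polytope P, has_dim P m,
      tight_face @` [set` DD] = [set F | face P F /\ F !=set0],
      forall S S', S \in DD -> tight_face S `<=` tight_face S' <-> S' \subset S &
      forall x, vertex P x <-> P x /\ tight x \in MM].
Proof.
split; [exact: polyhedron_simple | exact: polyhedron_dim | exact: polyhedron_faces
  | exact: tight_face_sub | exact: vertex_tight].
Qed.

End Polyhedron.

(** * The associahedron *)

Section ChordFunctional.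
Local Open Scope ring_scope.
Variables (R : realType) (n : nat) (A : rel 'I_n.-1).
Local Notation c := (polygon A).
Implicit Types a b i u w x y p q : 'I_n.+2.
Implicit Types (v : 'rV[R]_n) (K L M N : {set 'I_n}).

Definition ksum v K : R := \sum_(l in K) v 0 l.

Definition triangular (k : nat) : R := k%:R * k.+1%:R / 2.

Lemma triangularE k : triangular k = (k%:R ^+ 2 + k%:R) / 2.
Proof. by rewrite /triangular -[k.+1%:R]natr1 mulrDr mulr1. Qed.

(** The slack of the inequality of a chord. It is defined for boundary edges as well, where it
    vanishes on the hyperplane, so sides of triangles and quadrilaterals need no case
    distinction. *)
Definition chordf v a b : R :=
  ksum v (K_of A a b) - triangular #|K_of A a b|.

(** Natural weights let one identity between label counts yield both an identity of coordinate sums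
    and, at the all-one vector, one of cardinalities. *)
Definition wsum v (f : 'I_n -> nat) : R := \sum_l (f l)%:R * v 0 l.

Lemma wsumD v f g : wsum v f + wsum v g = wsum v (fun l => f l + g l)%N.
Proof.
by rewrite /wsum -big_split; apply: eq_bigr => l _; rewrite natrD mulrDl.
Qed.

Lemma eq_wsum v f g : f =1 g -> wsum v f = wsum v g.
Proof. by move=> E; apply: eq_bigr => l _; rewrite E. Qed.

Lemma ksumE v K : ksum v K = wsum v (fun l => l \in K).
Proof.
rewrite /ksum big_mkcond; apply: eq_bigr => l _.
by case: (l \in K); rewrite ?mul1r ?mul0r.
Qed.

Lemma coord_wsum v l : v 0 l = wsum v (fun k => k == l).
Proof.
rewrite /wsum (bigD1 l) //= eqxx mul1r big1 ?addr0 // => k /negbTE ->.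
by rewrite mul0r.
Qed.

Lemma total_wsum v : \sum_k v 0 k = wsum v (fun=> 1%N).
Proof. by apply: eq_bigr => k _; rewrite mul1r. Qed.

Lemma ksum_card K : ksum (const_mx 1) K = #|K|%:R.
Proof.
rewrite /ksum (eq_bigr (fun=> 1)) => [|l _]; last by rewrite mxE.
by rewrite sumr_const.
Qed.

Lemma ksum_eq v K L M N :
  (forall l, (l \in K) + (l \in L) = (l \in M) + (l \in N))%N ->
  ksum v K + ksum v L = ksum v M + ksum v N.
Proof.
by move=> H; rewrite !ksumE !wsumD; exact: eq_wsum.
Qed.

Lemma card_eq K L M N :
  (forall l, (l \in K) + (l \in L) = (l \in M) + (l \in N))%N ->
  (#|K| + #|L| = #|M| + #|N|)%N.
Proof.
move=> /(ksum_eq (const_mx 1)); rewrite !ksum_card -!natrD.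
by move/eqP; rewrite eqr_nat => /eqP.
Qed.

(** The difference of the two sides is [(k - p) * (k - q)]. *)
Lemma triangular_convex (k l p q : nat) : (p + q = k + l)%N ->
  (p < k)%N -> (q < k)%N -> triangular p + triangular q < triangular k + triangular l.
Proof.
move=> E pk qk; rewrite !triangularE.
have {}E : p%:R + q%:R = k%:R + l%:R :> R by rewrite -!natrD E.
have {}pk : p%:R < k%:R :> R by rewrite ltr_nat.
have {}qk : q%:R < k%:R :> R by rewrite ltr_nat.
move: (k%:R) (l%:R) (p%:R) (q%:R) E pk qk => K L P Q E PK QK.
have : 0 < (K - P) * (K - Q) by rewrite mulr_gt0 // subr_gt0.
have -> : L = P + Q - K by rewrite E addrC addKr.
by lra.
Qed.

(** The coordinate sums of the two pairs agree because union and intersection preserve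
    multiplicities. The cardinality terms differ strictly by convexity, as the crossing sets are
    incomparable. *)
Lemma chordf_quad v a b x y : (a < x)%N -> (a < b)%N -> (x < y)%N ->
  crosses (upl A) a b x y ->
  chordf v a y + chordf v x b < chordf v a b + chordf v x y.
Proof.
move=> ax ab xy H; have xb := crosses_lt ax ab xy H; have ay := ltn_trans ax xy.
have E (l : 'I_n) : ((l \in K_of A a b) + (l \in K_of A x y) =
    (l \in K_of A a y) + (l \in K_of A x b))%N.
  rewrite !mem_K_of //; have [] := quad_inK l.+1 ax ab xy H.
  by case: (upl A x); do 4!case: inK.
have Ec := card_eq E; rewrite /chordf.
(* The side playing the role of the union contains both crossing sets. *)
have sub : forall l, if upl A x
    then (inK (upl A) a b l ==> inK (upl A) x b l) &&
         (inK (upl A) x y l ==> inK (upl A) x b l)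
    else (inK (upl A) a b l ==> inK (upl A) a y l) &&
         (inK (upl A) x y l ==> inK (upl A) a y l).
  move=> l; have [] := quad_inK l ax ab xy H.
  by case: (upl A x); do 4!case: inK.
have xn : (0 < x <= n)%N by have := ltn_ord b; lia.
have wn : (0 < minn b y <= n)%N.
  have := ltn_ord b; have := ltn_ord y; move: (H) => /and5P[_ _ _ + _].
  by move: ab ay; clear; lia.
have [h1 h2 h3 h4] := crosses_incomparable ax ab xy H erefl.
suff : triangular #|K_of A a b| + triangular #|K_of A x y| <
    triangular #|K_of A a y| + triangular #|K_of A x b|.
  by have := ksum_eq v E; lra.
have subl l := sub l; case Eu: (upl A x) subl h1 h2 h3 h4 => subl h1 h2 h3 h4.
  have s1 l : inK (upl A) a b l ==> inK (upl A) x b l by case/andP: (subl l).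
  have s2 l : inK (upl A) x y l ==> inK (upl A) x b l by case/andP: (subl l).
  rewrite [X in _ < X]addrC; apply: triangular_convex; first by rewrite Ec addnC.
    by apply: (proper_K_of ab xb xn s1); rewrite ?h1 // (implyP (s2 _)) ?h2.
  by apply: (proper_K_of xy xb wn s2); rewrite ?h4 // (implyP (s1 _)) ?h3.
have s1 l : inK (upl A) a b l ==> inK (upl A) a y l by case/andP: (subl l).
have s2 l : inK (upl A) x y l ==> inK (upl A) a y l by case/andP: (subl l).
apply: triangular_convex; first exact: Ec.
  by apply: (proper_K_of ab ay wn s1); rewrite ?h3 // (implyP (s2 _)) ?h4.
by apply: (proper_K_of xy ay xn s2); rewrite ?h2 // (implyP (s1 _)) ?h1.
Qed.

Lemma ksum_triangle v a b (l : 'I_n) : (a < label l)%N -> (label l < b)%N ->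
  ksum v (K_of A a (label l)) + ksum v (K_of A (label l) b) +
    (if up A (label l) then 0 else v 0 l) =
  ksum v (K_of A a b) + (if up A (label l) then \sum_k v 0 k + v 0 l else 0).
Proof.
move=> ai ib; have ab := ltn_trans ai ib.
have E (k : 'I_n) := triangle_inK (upl A) k.+1 ai ib.
rewrite upE !ksumE.
case: (upl A _) E => E; rewrite !addr0 ?coord_wsum ?total_wsum !wsumD;
  apply: eq_wsum => k; have := E k; rewrite !mem_K_of // label_val eqSS;
  by rewrite ?addn0 ?add1n => ->.
Qed.

(** Let [k1] and [k2] be the sizes for the short sides. For a down label the long side has size
    [k1 + k2 + 1], and the difference of the triangular numbers is [(k1 + 1) * (k2 + 1)]. For an up
    label the long side has size [k1 + k2 - n - 1]. *)
Lemma middle_coordinate v a b (l : 'I_n) : (a < label l)%N -> (label l < b)%N ->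
  \sum_k v 0 k = triangular n ->
  chordf v a (label l) = 0 -> chordf v (label l) b = 0 -> chordf v a b = 0 ->
  v 0 l = if up A (label l) then n.+1%:R - (mu A (label l) a * mu A (label l) b)%:R
          else (mu A (label l) a * mu A (label l) b)%:R.
Proof.
move=> ai ib; have lN : (label l <= n)%N by rewrite label_val.
rewrite mu_left // mu_right ?label_val // -label_val -upE /chordf.
have := ksum_triangle v ai ib; have := ksum_triangle (const_mx 1) ai ib.
rewrite !ksum_card; have le K : (#|K| <= n.+1)%N.
  by rewrite (leq_trans (max_card (mem K))) // card_ord.
have -> : \sum_k (const_mx 1 : 'rV[R]_n) 0 k = n%:R.
  rewrite (eq_bigr (fun=> 1)) => [|k _]; last by rewrite mxE.
  by rewrite sumr_const card_ord.
rewrite mxE !triangularE; case: (up A _);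
  rewrite natrM ?natrB // -?[#|_|.+1%:R]natr1 -?[#|_|.+1%:R]natr1 -?[n.+1%:R]natr1;
  move: (#|K_of A a (label l)|%:R) (#|K_of A (label l) b|%:R) (#|K_of A a b|%:R)
    (ksum v _) (ksum v _) (ksum v _) (\sum_k v 0 k) (v 0 l) (n%:R)
  => k1 k2 k3 s1 s2 s3 s t N E1 E2 E3 E4 E5.
  have -> : k3 = k1 + k2 - N - 1 by lra.
  by lra.
have -> : k3 = k1 + k2 + 1 by lra.
by lra.
Qed.

End ChordFunctional.

(** * The admissible polyhedron and its tight sets *)

Section Associahedron.
Local Open Scope classical_set_scope.
Local Open Scope ring_scope.
Variables (R : realType) (n : nat) (A : rel 'I_n.-1).
Hypothesis n2 : (2 <= n)%N.
Local Notation c := (polygon A).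
Implicit Types a b i u w x y p q : 'I_n.+2.
Implicit Types (v d : 'rV[R]_n) (D E : {set 'I_n.+2}) (S T : {set {set 'I_n.+2}}).

Definition normal D : 'rV[R]_n := \row_l (l \in chordK A D)%:R.
Definition bound D : R := triangular R #|chordK A D|.
Definition ones : 'rV[R]_n := const_mx 1.
Definition diagonals : {set {set 'I_n.+2}} := [set D | is_diagonal c D]%SET.

Local Notation P := (polyhedron diagonals normal bound ones (triangular R n)).
Local Notation tight := (tight diagonals normal bound).

Lemma dot_normal D v : dot (normal D) v = ksum v (chordK A D).
Proof. by rewrite ksumE; apply: eq_bigr => l _; rewrite mxE. Qed.

Lemma dot_ones v : dot ones v = \sum_l v 0 l.
Proof. by apply: eq_bigr => l _; rewrite mxE mul1r. Qed.

Lemma is_diagonal_lt D : is_diagonal c D -> exists a b, (a < b)%N /\ D = [set a; b]%SET.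
Proof. by case/andP => /set2_lt. Qed.

Lemma admissibleE L : admissible A L <-> exists2 D, D \in diagonals & L = chordK A D.
Proof.
split=> [[a [b [ab D ->]]]|[D]].
  by exists [set a; b]%SET; rewrite ?inE // chordKE.
rewrite inE => Dd ->; have [a [b [ab DE]]] := is_diagonal_lt Dd.
by exists a, b; split=> //; rewrite -?DE // DE chordKE.
Qed.

Lemma half_spaceE (L : {set 'I_n}) v : \sum_l v 0 l = triangular R n ->
  half_space L v <-> triangular R #|L| <= ksum v L.
Proof.
rewrite /half_space /= => vh.
have -> : \sum_(l in ~: L) v 0 l = triangular R n - ksum v L.
  rewrite -vh [\sum_l v 0 l](bigID (mem L)) /= addrAC subrr add0r.
  by apply: eq_bigl => l; rewrite inE.
rewrite -/(ksum v L) !triangularE.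
have n0 : 0 < n%:R :> R by rewrite ltr0n (leq_trans _ n2).
move: (ksum v L) (#|L|%:R : R) (n%:R : R) n0 => s k N N0.
have -> : (N - k) * s - k * ((N ^+ 2 + N) / 2 - s) + N * k * (N - k) / 2 =
  N * (s - (k ^+ 2 + k) / 2) by field.
by rewrite pmulr_rge0 // subr_ge0.
Qed.

Lemma admissible_polyhedron : admissible_intersection R A = P.
Proof.
apply/seteqP; split=> v [vh vL].
  split; first by rewrite dot_ones vh.
  move=> D Dd; rewrite dot_normal; apply/half_spaceE => //.
  by apply: vL; apply/admissibleE; exists D.
rewrite dot_ones in vh; split=> // L /admissibleE[D Dd ->].
by apply/half_spaceE => //; rewrite -dot_normal; exact: vL.
Qed.

(** No chord crosses a boundary edge, so all labels lie on the same side of it. *)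
Lemma boundary_K a b : (a < b)%N -> boundary_edge c [set a; b]%SET ->
  K_of A a b = finset.set0 \/ K_of A a b = finset.setT.
Proof.
move=> ab Bab; have n0 : (0 < n)%N by rewrite (leq_trans _ n2).
have const l l' : (l \in K_of A a b) = (l' \in K_of A a b).
  rewrite !mem_K_of //; apply: (uncrossed_inK (n := n)) => //.
  - exact: upl0.
  - exact: upl_max.
  - by rewrite -ltnS.
  - by rewrite ltn_ord.
  - by rewrite ltn_ord.
  move=> u w un wn; rewrite -[u](@inordK n.+1) // -[w](@inordK n.+1) //.
  rewrite -xing_crosses //.
  exact: (boundary_uncrossed (uniq_polygon A) (@mem_polygon n A)).
case: (boolP (Ordinal n0 \in K_of A a b)) => H; [right|left]; apply/setP => l.
  by rewrite (const l (Ordinal n0)) H !inE.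
by rewrite (const l (Ordinal n0)) (negbTE H) !inE.
Qed.

Lemma chordf_boundary v a b : \sum_l v 0 l = triangular R n -> (a < b)%N ->
  boundary_edge c [set a; b]%SET -> chordf A v a b = 0.
Proof.
move=> vh ab /(boundary_K ab); rewrite /chordf => -[->|->].
  by rewrite /ksum big_set0 cards0 triangularE; lra.
rewrite cardsT card_ord /ksum (eq_bigl xpredT); first by rewrite vh subrr.
by move=> l; rewrite inE.
Qed.

Lemma ksum_boundary d a b : \sum_l d 0 l = 0 -> (a < b)%N ->
  boundary_edge c [set a; b]%SET -> ksum d (K_of A a b) = 0.
Proof.
move=> d0 ab /(boundary_K ab) [->|->]; first by rewrite /ksum big_set0.
rewrite /ksum (eq_bigl xpredT) ?d0 // => l; first by rewrite inE.
Qed.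

Lemma chord_cases a b : (a < b)%N ->
  [set a; b]%SET \in diagonals \/ boundary_edge c [set a; b]%SET.
Proof.
move=> ab; rewrite inE /is_diagonal cards2.
have -> /= : a != b by rewrite -val_eqE /= ltn_eqF.
by case: boundary_edge; auto.
Qed.

Lemma chordf_tight v D a b : (a < b)%N -> D = [set a; b]%SET ->
  (dot (normal D) v == bound D) = (chordf A v a b == 0).
Proof.
by move=> ab ->; rewrite dot_normal /bound chordKE // /chordf subr_eq0.
Qed.

Lemma chordf_ge0 v a b : P v -> (a < b)%N -> 0 <= chordf A v a b.
Proof.
move=> [vh vD] ab; rewrite dot_ones in vh.
case: (chord_cases ab) => [/vD|B]; last by rewrite chordf_boundary.
by rewrite dot_normal /bound chordKE // /chordf subr_ge0.
Qed.

(** The quadrilateral inequality without assuming which chord has the least label, together with the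
    crossing data needed for the induction in [maximal_feasible]. *)
Lemma chordf_crossing v a b x y : (a < b)%N -> (x < y)%N ->
  crosses (upl A) a b x y -> exists p q r s : 'I_n.+2, [/\ (p < q)%N, (r < s)%N,
    chordf A v p q + chordf A v r s < chordf A v a b + chordf A v x y,
    forall u w, (u < w)%N -> crosses (upl A) p q u w || crosses (upl A) r s u w ->
      crosses (upl A) a b u w || crosses (upl A) x y u w &
    ~~ crosses (upl A) p q x y && ~~ crosses (upl A) r s x y].
Proof.
move=> ab xy H; case: (ltngtP a x) => [ax|xa|/val_inj E].
- have xb := crosses_lt ax ab xy H.
  exists a, y, x, b; split=> //; first exact: ltn_trans ax xy.
  + exact: chordf_quad.
  + by move=> u w uw; exact: quad_crosses.
  + by rewrite /crosses !eqxx !andbF.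
- have H' : crosses (upl A) x y a b by rewrite crosses_sym.
  have ay := crosses_lt xa xy ab H'.
  exists x, b, a, y; split=> //; first exact: ltn_trans xa ab.
  + by rewrite [X in _ < X]addrC; exact: chordf_quad.
  + by move=> u w uw /(quad_crosses xa xy ab uw H'); rewrite orbC.
  + by rewrite /crosses !eqxx !andbF.
- by move: H; rewrite E /crosses eqxx.
Qed.

Lemma tight_dissection v : P v -> tight v \in dissections c.
Proof.
move=> Pv; rewrite inE; apply/andP; split.
  by apply/forall_inP => D /tight_Diag; rewrite inE.
apply/forall_inP => D Dv; apply/forall_inP => E Ev; apply/negP => DE.
have tightE F : F \in tight v -> exists a b,
    [/\ (a < b)%N, F = [set a; b]%SET & chordf A v a b = 0].
  move=> Fv; have := tight_Diag Fv; rewrite inE => /is_diagonal_lt[a [b [ab FE]]].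
  by exists a, b; split=> //; apply/eqP; rewrite -(chordf_tight v ab FE) (tightP Fv).
have [a [b [ab Dab ab0]]] := tightE _ Dv; have [x [y [xy Exy xy0]]] := tightE _ Ev.
move: DE; rewrite Dab Exy crossing_crosses // => H.
have [p [q [r [s [pq rs lt _ _]]]]] := chordf_crossing v ab xy H.
have := chordf_ge0 Pv pq; have := chordf_ge0 Pv rs; move: lt; rewrite ab0 xy0; lra.
Qed.

Section Maximal.
Variable T : {set {set 'I_n.+2}}.
Hypothesis mT : maximal A T.

(* A chord crossing T is compared with the two sides of a quadrilateral that
   cross fewer diagonals of T. *)
Lemma maximal_feasible v : \sum_l v 0 l = triangular R n ->
  (forall a b, (a < b)%N -> [set a; b]%SET \in T -> chordf A v a b = 0) ->
  forall a b, (a < b)%N -> 0 <= chordf A v a b /\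
    (chordf A v a b = 0 -> tri_edge c T a b).
Proof.
move=> vh vT a b; pose X a b := [set E in T | crossing c [set a; b]%SET E]%SET.
move: {2}#|X a b| (leqnn #|X a b|) => k; elim: k a b => [|k IHk] a b Xk ab.
all: have [X0|[E]] := set_0Vmem (X a b).
1,3: have eab : tri_edge c T a b.
1,3: apply: (tri_edge_uncrosses mT ab) => u w uw uwT;
     rewrite -crossing_crosses //; apply/negP => H;
     by have : [set u; w]%SET \in X a b; [rewrite inE uwT | rewrite X0 inE].
1,2: by split=> //; case/orP: eab => [/vT->|/chordf_boundary ->].
all: rewrite inE => /andP[ET]; have [x [y [xy Exy]]] := dissection_lt mT.1 ET.
all: rewrite Exy in ET *; move=> cE.
  have : [set x; y]%SET \in X a b by rewrite inE ET.
  by move: Xk; rewrite leqn0 cards_eq0 => /eqP ->; rewrite inE.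
have H : crosses (upl A) a b x y by rewrite -crossing_crosses.
have [p [q [r [s [pq rs lt sub /andP[npq nrs]]]]]] := chordf_crossing v ab xy H.
(* A side crosses only diagonals of [T] that already cross [a b], since none of them crosses [x y];
   and it no longer crosses [x y] itself. *)
have step u w : (u < w)%N -> (forall u' w', (u' < w')%N -> crosses (upl A) u w u' w' ->
    crosses (upl A) p q u' w' || crosses (upl A) r s u' w') ->
    ~~ crosses (upl A) u w x y -> 0 <= chordf A v u w.
  move=> uw imp nuw; apply: (IHk _ _ _ uw).1; rewrite -ltnS; apply: leq_trans Xk.
  apply/proper_card/properP; split.
    apply/fintype.subsetP => F; rewrite !inE => /andP[FT]; rewrite FT.
    have [u' [w' [uw' FE]]] := dissection_lt mT.1 FT; rewrite FE in FT *.
    rewrite !crossing_crosses // => /(imp _ _ uw')/(sub _ _ uw')/orP[] // H2.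
    by have := dissection_uncrossed mT.1 xy ET FT; rewrite H2.
  exists [set x; y]%SET; first by rewrite inE ET.
  by rewrite inE negb_and crossing_crosses // nuw orbT.
have h1 : 0 <= chordf A v p q by apply: step => // u' w' _ ->.
have h2 : 0 <= chordf A v r s by apply: step => // u' w' _ ->; rewrite orbT.
(* The slack of a crossed chord is strictly positive, so the second claim holds vacuously. *)
move: lt; rewrite (vT _ _ xy ET) => lt; split; lra.
Qed.

Definition pairs D := [pred ij : 'I_n * 'I_n | [&& ij.1 \in chordK A D,
  ij.2 \notin chordK A D &
  [forall E in T, (E != D) ==> ((ij.1 \in chordK A E) == (ij.2 \in chordK A E))]]].

(** The direction of the edge of the polytope along which only [D] becomes loose. By
    [separating_pair] the default 0 does not occur for [D] in [T]. *)
Definition flip_direction D : 'rV[R]_n :=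
  if [pick ij | pairs D ij] is Some ij then delta_mx 0 ij.1 - delta_mx 0 ij.2 else 0.

Lemma dot_delta d (l : 'I_n) : dot d (delta_mx 0 l) = d 0 l.
Proof.
rewrite /dot (bigD1 l) //= mxE !eqxx mulr1 big1 ?addr0 // => k /negbTE kl.
by rewrite mxE kl andbF mulr0.
Qed.

Lemma ones_flip D : dot ones (flip_direction D) = 0.
Proof.
rewrite /flip_direction; case: pickP => [ij _|_]; last by rewrite dot0r.
by rewrite dotBr !dot_delta !mxE subrr.
Qed.

Lemma normal_flip D E : D \in T -> E \in T ->
  dot (normal E) (flip_direction D) = (E == D)%:R.
Proof.
move=> DT ET; rewrite /flip_direction; case: pickP => [ij|none].
  case/and3P => i1 i2 /forall_inP/(_ _ ET) same.
  rewrite dotBr !dot_delta !mxE; case: eqP same => [-> _|_ /= /eqP ->].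
    by rewrite i1 (negbTE i2) subr0.
  by rewrite subrr.
have [i [j [iD jD same]]] := separating_pair mT DT.
have := none (i, j); rewrite /= iD jD /=.
have -> // : [forall E0 in T, (E0 != D) ==> ((i \in chordK A E0) == (j \in chordK A E0))].
by apply/forall_inP => F FT; apply/implyP => FD; rewrite same.
Qed.

Lemma label_bounds (l : 'I_n) : (0 < label l <= n)%N.
Proof. by rewrite label_val ltn_ord. Qed.

Lemma maximal_kernel d : dot ones d = 0 ->
  (forall E, E \in T -> dot (normal E) d = 0) -> d = 0.
Proof.
rewrite dot_ones => d0 dE; apply/rowP => l; rewrite mxE.
have [a [b [/andP[al lb] [e1 e2 e3 _ _]]]] := middle_triangle mT (label_bounds l).
have edge0 x y : (x < y)%N -> tri_edge c T x y -> ksum d (K_of A x y) = 0.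
  move=> xy; case/orP => [/dE|]; last exact: ksum_boundary.
  by rewrite dot_normal chordKE.
have := ksum_triangle A d al lb.
by rewrite !edge0 // ?(ltn_trans al) // d0; case: (up A _); lra.
Qed.

(** The flip directions are independent and orthogonal to [ones], so there are at most [n - 1] of
    them. Conversely the hyperplane orthogonal to [ones] has dimension [n - 1] and pairs injectively
    with the normals of [T]. *)
Lemma maximal_card : #|T| = n.-1.
Proof.
apply/eqP; rewrite eqn_leq; apply/andP; split.
  pose X := \matrix_(i < #|T|) flip_direction (enum_val i).
  have Xfree : row_free X.
    apply/row_freeP; exists (\matrix_(l, j) normal (enum_val j) 0 l).
    apply/matrixP => i j; rewrite !mxE.
    rewrite -(inj_eq enum_val_inj) eq_sym -normal_flip ?enum_valP //.
    by apply: eq_bigr => l _; rewrite !mxE mulrC.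
  have X1 : X *m ones^T = 0.
    apply/row_matrixP => i; rewrite row_mul rowK row0; apply/matrixP => j k.
    by rewrite !ord1 dotE ones_flip mxE.
  have := mulmx0_rank_max X1; rewrite mxrank_tr rank_rV (eqP Xfree).
  have -> : ones != 0.
    apply/eqP => /rowP/(_ (Ordinal (ltnW n2))); rewrite !mxE => /eqP.
    by rewrite oner_eq0.
  by move: n2 #|T|; clear; lia.
pose K := kermx (ones^T : 'M[R]_(n, 1)).
have rK : (n.-1 <= \rank K)%N.
  by rewrite mxrank_ker mxrank_tr rank_rV -subn1 leq_sub2l // leq_b1.
apply: leq_trans rK _.
rewrite -[T]finset.setD0.
apply: (@orthogonal_family_card _ _ _ normal ones [set T]%SET _ _
  (row_base K) T finset.set0).
- move=> T' d; rewrite inE => /eqP ->; exact: maximal_kernel.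
- by rewrite inE.
- exact: row_base_free.
- move=> i; rewrite -dotE.
  have : (row i (row_base K) <= K)%MS.
    by rewrite (submx_trans (row_sub _ _)) // eq_row_base.
  by move=> /sub_kermxP ->; rewrite mxE.
- by move=> i D; rewrite inE.
Qed.

Lemma M_of_unique v : \sum_l v 0 l = triangular R n ->
  (forall a b, (a < b)%N -> [set a; b]%SET \in T -> chordf A v a b = 0) ->
  v = M_of R A T.
Proof.
move=> vh vT; apply/rowP => l; rewrite mxE.
have [a [b [/andP[al lb] [e1 e2 e3 pl pr]]]] := middle_triangle mT (label_bounds l).
have edge0 x y : (x < y)%N -> tri_edge c T x y -> chordf A v x y = 0.
  by move=> xy /orP[/vT->|/chordf_boundary->].
have ab := ltn_trans al lb.
by rewrite (@middle_coordinate _ _ A v a b) ?edge0 // /weight pl pr.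
Qed.

(** A solution is built by correcting the constant vector of the hyperplane along the dual flip
    directions; by uniqueness it has the coordinates of [M_of]. *)
Lemma M_of_equations : \sum_l (M_of R A T) 0 l = triangular R n /\
  forall a b, (a < b)%N -> [set a; b]%SET \in T -> chordf A (M_of R A T) a b = 0.
Proof.
have n0 : n%:R != 0 :> R by rewrite pnatr_eq0 -lt0n (leq_trans _ n2).
pose y : 'rV[R]_n := const_mx (triangular R n / n%:R).
pose v := y - \sum_(D in T) (dot (normal D) y - bound D) *: flip_direction D.
have vh : \sum_l v 0 l = triangular R n.
  rewrite -dot_ones dotBr dot_sumr big1 ?subr0 => [|D _].
    rewrite dot_ones (eq_bigr (fun=> triangular R n / n%:R)) => [|l _].
      by rewrite sumr_const card_ord -[X in X = _]mulr_natr divfK.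
    by rewrite mxE.
  by rewrite dotZr ones_flip mulr0.
suff vT : forall a b, (a < b)%N -> [set a; b]%SET \in T -> chordf A v a b = 0.
  by rewrite -(M_of_unique vh vT).
move=> a b ab abT; apply/eqP; rewrite -(chordf_tight _ ab erefl) dotBr dot_sumr.
rewrite (bigD1 [set a; b]%SET) //= dotZr normal_flip // eqxx mulr1 big1 ?addr0.
  by apply/eqP; ring.
move=> D /andP[DT Dab]; rewrite dotZr normal_flip // eq_sym (negbTE Dab).
by rewrite mulr0.
Qed.

Lemma M_of_polyhedron : P (M_of R A T).
Proof.
have [vh vT] := M_of_equations; split; first by rewrite dot_ones.
move=> D; rewrite inE => /is_diagonal_lt[a [b [ab ->]]].
have [H _] := maximal_feasible vh vT ab.
by rewrite dot_normal /bound chordKE // -subr_ge0.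
Qed.

Lemma tight_M_of : tight (M_of R A T) = T.
Proof.
have [vh vT] := M_of_equations; apply/setP => D; apply/idP/idP => DT.
  have := tight_Diag DT; rewrite inE => Dd; have [a [b [ab DE]]] := is_diagonal_lt Dd.
  have [_ H] := maximal_feasible vh vT ab.
  have : tri_edge c T a b.
    by apply: H; apply/eqP; rewrite -(chordf_tight _ ab DE) (tightP DT).
  case/orP; rewrite -DE // => B.
  by move: Dd; rewrite /is_diagonal B andbF.
have [a [b [ab DE]]] := dissection_lt mT.1 DT.
rewrite inE (chordf_tight _ ab DE) vT ?eqxx -?DE // andbT inE.
by have := mT.1; rewrite inE => /andP[/forall_inP/(_ _ DT)].
Qed.

End Maximal.

(** All maximal dissections have the same size, so a dissection of that size equals any maximal one
    extending it. *)
Lemma triangulationP T : T \in triangulations c <-> maximal A T.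
Proof.
rewrite inE card_ord; split=> [/andP[TD /eqP cT]|mT].
  have [T' mT' TT'] := dissection_extend TD.
  suff -> : T = T' by [].
  by apply/eqP; rewrite eqEcard TT' (maximal_card mT') cT !subSS subn1 leqnn.
by rewrite mT.1 (maximal_card mT) !subSS subn1 eqxx.
Qed.

Lemma gap_K_of (e : bool) a b l : (a < b)%N -> gap (upl A) n e a b ->
  (l \in K_of A a b) = e.
Proof.
move=> ab G; rewrite mem_K_of //.
by apply: (gap_inK (upl0 A) (upl_max A) ab _ G); rewrite ltn_ord.
Qed.

(** Two triangles with middle label [l] give opposite signs for its coordinate: one has two boundary
    edges as its short sides, the other has as its long side the boundary edge of the opposite chain
    passing over [l]. *)
Lemma recession_trivial d : dot ones d = 0 ->
  (forall D, D \in diagonals -> 0 <= dot (normal D) d) -> d = 0.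
Proof.
rewrite dot_ones => d0 dD; apply/rowP => l; rewrite mxE.
have chord_ge0 a b : (a < b)%N -> 0 <= ksum d (K_of A a b).
  move=> ab; case: (chord_cases ab) => [/dD|]; last by move/ksum_boundary->.
  by rewrite dot_normal chordKE.
have gap0 (e : bool) a b : (a < b)%N -> gap (upl A) n e a b -> ksum d (K_of A a b) = 0.
  move=> ab G; case: e G => G.
    rewrite /ksum (eq_bigl xpredT) // => k; exact: (gap_K_of _ ab G).
  by rewrite /ksum big_pred0 // => k; exact: (gap_K_of _ ab G).
have /andP[l0 ln] := label_bounds l; pose e := upl A (label l).
have [a1 al1 [ga1 gk1]] := gap_left_ord A e l0.
have [b1 lb1 [gb1 gm1]] := gap_right_ord A e ln.
have [a2 al2 [ga2 gk2]] := gap_left_ord A (~~ e) l0.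
have [b2 lb2 [gb2 gm2]] := gap_right_ord A (~~ e) ln.
have G1 : gap (upl A) n e a1 (label l) by split=> //; rewrite eqxx orbT.
have G2 : gap (upl A) n e (label l) b1 by split=> //; rewrite eqxx orbT.
have G3 : gap (upl A) n (~~ e) a2 b2.
  split=> // k; apply/implyP => /andP[ak kb].
  case: (ltngtP k (label l)) => [kl|kl|->]; last by rewrite negbK.
    by move: (gk2 k); rewrite ak kl.
  by move: (gm2 k); rewrite kl kb.
have := ksum_triangle A d al1 lb1; have := ksum_triangle A d al2 lb2.
rewrite (gap0 _ _ _ al1 G1) (gap0 _ _ _ lb1 G2) (gap0 _ _ _ (ltn_trans al2 lb2) G3) d0.
have := chord_ge0 _ _ (ltn_trans al1 lb1); have := chord_ge0 _ _ al2.
have := chord_ge0 _ _ lb2; case: (up A (label l)); lra.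
Qed.

Lemma admissible_structure (Q := admissible_intersection R A)
    (F := tight_face diagonals normal bound ones (triangular R n)) :
  [/\ simple_polytope Q, has_dim Q n.-1,
      F @` [set` dissections c] = [set G | face Q G /\ G !=set0],
      forall S S', S \in dissections c -> F S `<=` F S' <-> S' \subset S &
      forall v, vertex Q v <-> Q v /\ tight v \in triangulations c].
Proof.
rewrite /Q admissible_polyhedron.
apply: (@polyhedron_structure _ _ _ _ _ _ _ _ _ _ _ (M_of R A) flip_direction).
- exact: tight_dissection.
- by move=> S /dissection_extend[T /triangulationP TM ST]; exists T.
- by move=> S T TD ST; exact: dissections_sub TD ST.
- by move=> T /triangulationP[].
- by move=> T /triangulationP; exact: maximal_card.
- by move=> T /triangulationP; exact: M_of_polyhedron.
- by move=> T /triangulationP; exact: tight_M_of.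
- by move=> T D _ _; exact: ones_flip.
- by move=> T D E /triangulationP mT; exact: normal_flip.
- by move=> T d /triangulationP mT; exact: maximal_kernel.
- exact: recession_trivial.
- by rewrite inE; apply/andP; split; apply/forall_inP => D; rewrite inE.
Qed.

End Associahedron.

(** * Transfer to the standard polygon *)

Local Open Scope classical_set_scope.

Theorem theorem2p12 (R : realType) (n : nat) (hn : (2 <= n)%N)
    (A : rel 'I_n.-1) (hA : path_orientation A) :
  associahedron n.-1 (admissible_intersection R A) /\
  [set x | vertex (admissible_intersection R A) x] =
  [set M_of R A T | T in [set` triangulations (polygon A)]].
Proof.
have [simple dim faces sub vertices] := admissible_structure R A hn.
split; last first.
  apply/seteqP; split=> [x /vertices[Px xT]|_ [T TT <-]].
    have mT := (triangulationP R A hn _).1 xT.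
    exists (tight (diagonals A) (normal R A) (bound R A) x) => //.
    apply/esym/(M_of_unique hn mT); rewrite (admissible_polyhedron R A hn) in Px.
      by rewrite -dot_ones Px.1.
    move=> a b ab abT; apply/eqP; rewrite -(chordf_tight A x ab erefl).
    exact/eqP/(tightP abT).
  have mT := (triangulationP R A hn _).1 TT.
  apply/vertices; rewrite (tight_M_of R hn mT) (admissible_polyhedron R A hn).
  by split=> //; exact: (M_of_polyhedron R hn mT).
split=> //.
have n0 : n.-1.+3 = n.+2 by rewrite prednK // ltnW.
(* A vertex is sent to its position, which turns the order of the labelled polygon into that of
   [enum]. The cast is there because [n.-1.+3] equals [n.+2] only for positive [n]. *)
pose f (v : 'I_n.+2) : 'I_n.-1.+3 := cast_ord (esym n0) (inord (index v (polygon A))).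
pose f' (w : 'I_n.-1.+3) : 'I_n.+2 := nth ord0 (polygon A) w.
have pos_f v : f v = index v (polygon A) :> nat.
  by rewrite /= inordK // -[X in (_ < X)%N](size_polygon A) index_mem mem_polygon.
have fK : cancel f f' by move=> v; rewrite /f' pos_f nth_index ?mem_polygon.
have f'K : cancel f' f.
  move=> w; apply: ord_inj; rewrite pos_f index_uniq ?uniq_polygon //.
  by rewrite size_polygon -n0.
have idx v : index (f v) (enum 'I_n.-1.+3) = index v (polygon A).
  by rewrite index_enum_ord pos_f.
have idx' w : index (f' w) (polygon A) = index w (enum 'I_n.-1.+3).
  by rewrite -idx f'K.
have mem_e (w : 'I_n.-1.+3) : w \in enum 'I_n.-1.+3 by rewrite mem_enum.
have rel' S : S \in dissections (enum 'I_n.-1.+3) ->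
    relabel f' S \in dissections (polygon A).
  by apply: (relabel_dissections (f' := f)) => //;
    [exact: enum_uniq | exact: uniq_polygon | exact: mem_polygon].
have rel S : S \in dissections (polygon A) ->
    relabel f S \in dissections (enum 'I_n.-1.+3).
  by apply: (relabel_dissections (f' := f')) => //;
    [exact: uniq_polygon | exact: mem_polygon | exact: enum_uniq].
exists (fun S => tight_face (diagonals A) (normal R A) (bound R A) (ones R n)
  (triangular R n) (relabel f' S)); split.
  rewrite -faces; apply/seteqP; split=> [_ [S SD <-]|_ [S SD <-]].
    by exists (relabel f' S) => //; exact: rel'.
  by exists (relabel f S); [exact: rel | rewrite relabelK].
move=> S S' SD _; rewrite sub; last exact: rel'.
split=> [H|]; last exact: imsetS.
by rewrite -(relabelK f'K S) -(relabelK f'K S'); exact: imsetS.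
Qed.
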